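(* There are positive constants $c$ and $\alpha$ such that for every $\lambda>0$, every pair of distinct points $u,v\in\mathbb{R}^2$, all given directions $d_u,d_v\in\{(0,1),(1,0)\}$, any choice of signs $\sigma,\tau\in\{+,-\}$, and all $t>0$, $$\left|{\bf C}\left(A^{\sigma}_{u,d_u}(t),A^{\tau}_{v,d_v}(t)\mid u,v\in\mathcal V\right)\right|\le c\,e^{-\alpha\sqrt{\lambda}\,\|u-v\|_1}.$$
   Context: Rectangular Gilbert tessellation model: let $\mathcal V$ be the set of points of a homogeneous Poisson process on $\mathbb{R}^2$ with intensity $\lambda>0$. Each $w\in\mathcal V$ is assigned, independently of everything else, a direction $d_w\in\{(0,1),(1,0)\}$, each with probability $1/2$. At time $0$, from every $w\in\mathcal V$ two rays $\mathcal L^{+}_{w,d_w}$ and $\mathcal L^{-}_{w,d_w}$ start growing, in directions $+d_w$ and $-d_w$ respectively, with constant speed $1$; a ray grows until its tip reaches another ray (i.e. touches a point of a ray of another initial point as grown up to that time), at which moment it stops and remains unchanged thereafter. $\mathcal L^{\pm}_{w,d_w}(t)$ denotes the (closed) segment occupied by the ray at time $t$, and $L^{\pm}_{w,d_w}(t)=|\mathcal L^{\pm}_{w,d_w}(t)|\le t$ its length. Given the initial points and their directions the dynamics is deterministic. Events: $A^{\pm}_{w,d_w}(t)=\{L^{\pm}_{w,d_w}(t)=t\}$ (the ray has not stopped before time $t$). Conditioning on $\{u,v\in\mathcal V\}$ for fixed $u,v$ (with given $d_u,d_v$) means: the process is run from the initial set $\mathcal V\cup\{u,v\}$, where $\mathcal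 V$ is the Poisson process with its independent random directions and $u,v$ have the given directions. For events $A,B$ and a conditioning event $E$: ${\bf C}(A,B\mid E)=\mathbb P\{A\cap B\mid E\}-\mathbb P\{A\mid E\}\,\mathbb P\{B\mid E\}$. Also $\|u-v\|_1=|u_1-v_1|+|u_2-v_2|$. *)

(* Defs.v *)
From HB Require Import structures.
From mathcomp Require Import all_boot all_order all_algebra.
From mathcomp Require Import all_classical all_reals all_analysis.
Set Implicit Arguments.
Unset Strict Implicit.
Unset Printing Implicit Defensive.
Import Order.TTheory GRing.Theory Num.Theory numFieldNormedType.Exports.
Local Open Scope classical_set_scope.
Local Open Scope card_scope.
Local Open Scope ring_scope.

Section Dynamics.
Context {R : realType}.

(* Directions are booleans: [false] stands for (1,0) and [true] for (0,1). *)
Definition dirvec (d : bool) : R * R := if d then (0, 1) else (1, 0).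

(* Signs are booleans: [true] stands for + and [false] for -. *)
Definition sgn (s : bool) : R := if s then 1 else -1.

(* An initial point together with its direction. *)
Definition seed : Type := (R * R * bool)%type.

Record ray : Type := Ray { source : seed ; sign : bool }.

(* Position at time [s] of the tip of a ray that has not stopped before. *)
Definition tip (r : ray) (s : R) : R * R :=
  ((source r).1.1 + sgn (sign r) * s * (dirvec (source r).2).1,
   (source r).1.2 + sgn (sign r) * s * (dirvec (source r).2).2).

(* Since rays grow at unit speed until they stop, an evolution is described by
   the stopping times [T] of the rays, with value +oo for a ray that never
   stops. *)
Definition segment (T : ray -> \bar R) (r : ray) (t : R) : set (R * R) :=
  [set tip r s | s in [set s | 0 <= s <= t /\ (s%:E <= T r)%E]].

Definition len (T : ray -> \bar R) (r : ray) (t : R) : \bar R :=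
  Order.min t%:E (T r).

(* [ereal_inf set0 = +oo].  The two rays of one initial point do not stop each
   other, whence the condition on the sources.  Only the values of [T] on the
   rays issued from [S] are constrained, and only these rays act as obstacles. *)
Definition is_gilbert (S : set seed) (T : ray -> \bar R) : Prop :=
  forall r : ray, S (source r) ->
    T r = ereal_inf [set t%:E | t in [set t : R | 0 <= t /\
      exists r' : ray, [/\ S (source r'), (source r').1 <> (source r).1 &
        segment T r' t (tip r t)]]].

(* The evolution determined by the initial configuration [S]; the default value
   [+oo] is only used when no evolution exists, and if several evolutions differ
   on the rays issued from [S] an arbitrary one is taken.  Neither happens, up to
   an event of probability zero, in the Poisson model. *)
Definition gilbert (S : set seed) : ray -> \bar R :=
  xget (fun=> +oo%E) [set T | is_gilbert S T].

End Dynamics.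

Section Probability.
Context {R : realType} {d : measure_display} {Omega : measurableType d}.
Implicit Types (X : nat -> Omega -> R * R) (D : nat -> Omega -> bool).

(* The library's [poisson_pmf] takes the value 1 at every [k] when the rate is
   0, so it cannot be used for the counts in sets of zero area. *)
Definition poisson_weight (m : R) (k : nat) : R :=
  expR (- m) * m ^+ k / k`!%:R.

Definition area : set (R * R) -> \bar R :=
  (@lebesgue_measure R \x @lebesgue_measure R)%E.

Definition sigma_points X : set (set Omega) :=
  <<s \bigcup_i preimage_set_system setT (X i) measurable >>.

(* The homogeneous Poisson process of intensity [lambda] is enumerated by [X],
   and [D i] is the direction of the point [X i].  As a planar Poisson process
   is almost surely infinite, it has such an enumeration, and marking its points
   independently of everything else amounts to attaching to this enumeration an
   i.i.d. sequence that is independent of it. *)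
Record marked_poisson (lambda : R) (P : probability Omega R) X D : Prop := {
  mp_measurable_points : forall i, measurable_fun setT (X i) ;
  mp_measurable_dirs : forall i, measurable_fun setT (D i) ;
  mp_simple : {ae P, forall w, injective (X ^~ w)} ;
  mp_counts : forall (n : nat) (B : 'I_n -> set (R * R)) (k : 'I_n -> nat),
    (forall j, measurable (B j)) ->
    (forall j, (area (B j) < +oo)%E) ->
    trivIset setT B ->
    P (\bigcap_(j in [set: 'I_n])
         [set w | [set i | B j (X i w)] #= `I_(k j)]) =
    (\prod_(j < n) poisson_weight (lambda * fine (area (B j))) (k j))%:E ;
  mp_dirs : forall (E : set Omega) (n : nat) (b : nat -> bool),
    sigma_points X E ->
    P (E `&` \bigcap_(i in `I_n) [set w | D i w = b i]) =
    (P E * ((2^-1 : R) ^+ n)%:E)%E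
}.

(* Initial configuration under the conditioning on two given points. *)
Definition config X D (a b : seed) (w : Omega) : set seed :=
  [set (X i w, D i w) | i in [set: nat]] `|` [set a; b].

(* The event that the ray [r] has not stopped before time [t], when the process
   is run from the initial configuration [S w]. *)
Definition A (S : Omega -> set (@seed R)) (r : ray) (t : R) : set Omega :=
  [set w | len (gilbert (S w)) r t = t%:E].

(* The evolution is well defined only almost surely, so that the events of
   interest are measurable for the completion of [P] but not necessarily for the
   sigma-algebra of [Omega]; the outer measure [P^*] extends the completion. *)
Definition Cov (P : probability Omega R) (E F : set Omega) : R :=
  fine ((P^*)%mu (E `&` F)) - fine ((P^*)%mu E) * fine ((P^*)%mu F).

End Probability.

Definition dist1 {R : realType} (u v : R * R) : R :=
  `|u.1 - v.1| + `|u.2 - v.2|.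

(* Main.v *)
(* Information travels at unit speed, so whether a ray is still growing at time
   t depends only on the seeds in the box of radius t around the point where its
   tip would then be. If 8 t < |u - v|_1, the boxes of the two rays are disjoint
   and the two events are independent, so the covariance vanishes. If t is at
   least |u - v|_1 / 16, the covariance is at most the probability that the ray
   of u survives until that time. Along the ray there are about
   sqrt(lambda) |u - v|_1 / 160 disjoint boxes of size of order 1 / sqrt(lambda);
   independently in each of them, with a fixed positive probability, the Poisson
   points form a local pattern that stops the ray for sure.

   Only the probabilities that a set contains no marked point are needed: the
   events "no marked point in V" are stable under intersection, so their product
   formula gives the independence of the sigma-algebras that they generate, and
   in these sigma-algebras the survival events are measurable. *)
From HB Require Import structures.
Require Import Defs.
From mathcomp Require Import all_boot all_order all_algebra finmap.
From mathcomp Require Import all_classical all_reals all_analysis.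
From mathcomp Require Import measurable_realfun ring lra.
Set Implicit Arguments.
Unset Strict Implicit.
Unset Printing Implicit Defensive.
Import Order.TTheory GRing.Theory Num.Theory numFieldNormedType.Exports.
Local Open Scope classical_set_scope.
Local Open Scope ring_scope.

(** * The deterministic dynamics *)

Section Dynamics.
Context {R : realType}.
Implicit Types (S : set (@seed R)) (r : @ray R) (p q : R * R).

(** The dynamics is self-referential: a ray stops another one only if it has itself survived long
    enough. General position is not what resolves this. If two rays meet after times [h] and
    [s <= h], then [h + s] is the l1 distance of their sources, so half of this distance separates
    [s] from [h], also when both tips arrive together. A bounded region contains finitely many
    half-distances, hence chains of dependence are finite: every locally finite set of seeds has
    exactly one evolution on its rays, obtained from approximations of finite depth. Each
    approximation is a nested statement about the existence of seeds. The measurability of such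
    statements is proved for configurations that are locally finite at every outcome, so the Poisson
    points are replaced by a version that is empty on a null event, and outer measures are compared
    with those of measurable events. The law of the marked points is not given directly, only the
    counts of the unmarked ones and independent directions attached to an enumeration; a thinning
    argument turns this into void probabilities for marked sets. *)

Definition box p (a : R) : set (R * R) :=
  [set q | `|q.1 - p.1| <= a /\ `|q.2 - p.2| <= a].

(* The last equation discards the redundant hits where [r] follows the trail of
   [r'] beyond the source of [r'], in the direction in which both grow: [r] has
   then been stopped already by that source. *)
Definition meeting r r' (h s : R) : Prop :=
  [/\ 0 <= s <= h, (source r').1 <> (source r).1, tip r h = tip r' s &
      h + s = dist1 (source r).1 (source r').1].

Lemma meeting_of_hit r r' (h s : R) : 0 <= s <= h ->
  (source r').1 <> (source r).1 -> tip r h = tip r' s ->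
  exists h0 s0, [/\ meeting r r' h0 s0, h0 <= h & s0 <= s].
Proof.
case: r r' => [[[x y] d] b] [[[x' y'] d'] b'] /=.
rewrite /meeting /tip /dist1 /= => /andP[s0 sh] neq [].
case: (boolP ((d == d') && (b == b'))) => [/andP[/eqP <- /eqP <-] e1 e2|ndb e1 e2].
  exists (h - s), 0; split; [split=> //|lra|lra].
  - by apply/andP; split; lra.
  - by move: e1 e2; case: d; case: b => /= e1 e2; congr (_, _); lra.
  - move: e1 e2; case: d; case: b => /= e1 e2.
    + have -> : x - x' = 0 by lra. rewrite normr0 ler0_norm; lra.
    + have -> : x - x' = 0 by lra. rewrite normr0 ger0_norm; lra.
    + have -> : y - y' = 0 by lra. rewrite normr0 ler0_norm; lra.
    + have -> : y - y' = 0 by lra. rewrite normr0 ger0_norm; lra.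
(* Otherwise the two trails form a monotone path between the sources, of length [h + s]. *)
exists h, s; split=> //; split=> //; first by rewrite s0.
  by rewrite e1 e2.
move: ndb e1 e2; case: d; case: d' => //=; case: b; case: b' => //= _ e1 e2.
all: case: (ger0P (x - x')) => ?; case: (ger0P (y - y')) => ?; lra.
Qed.

Lemma meeting_half r r' (h s : R) : meeting r r' h s ->
  s <= dist1 (source r).1 (source r').1 / 2 <= h.
Proof. by case=> /andP[s0 sh] _ _ <-; apply/andP; split; lra. Qed.

Lemma tip_box r (s h : R) : h <= s -> box (tip r s) (s - h) (tip r h).
Proof.
case: r => [[[x y] d] b]; rewrite /box /tip /= !ler_norml.
by case: d; case: b => /= hs; split; apply/andP; split; lra.
Qed.

Lemma source_box r (s : R) : 0 <= s -> box (tip r s) s (source r).1.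
Proof.
move=> s0; have := tip_box r s0; rewrite subr0.
by case: r => [[[x y] d] b]; rewrite /tip /= !mulr0 !mul0r !addr0.
Qed.

Lemma box_sub p q (a b : R) : box p a q -> box q b `<=` box p (a + b).
Proof.
by rewrite /box /= => -[+ +] [x y] /= [+ +]; rewrite !ler_norml => /andP[? ?] /andP[? ?]
  /andP[? ?] /andP[? ?]; split; apply/andP; split; lra.
Qed.

(* The light cone of the tip. *)
Lemma meeting_cone r r' (h s s' : R) : h < s -> meeting r r' h s' ->
  box (tip r' s') s' `<=` box (tip r s) s.
Proof.
move=> hs [/andP[s0 sh] _ e _]; have := tip_box r (ltW hs); rewrite e.
move=> /(@box_sub _ _ _ s')/subset_trans; apply => -[x y] [/= h1 h2].
by split; [apply: le_trans h1 _|apply: le_trans h2 _]; lra.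
Qed.

(* [f n r s] approximates at depth [n] the event that [r] is not stopped before
   time [s]; a constant sequence satisfying this is an exact evolution. *)
Definition recursive S (f : nat -> @ray R -> R -> Prop) := forall n r s,
  S (source r) -> (f n.+1 r s <-> forall r' h s', S (source r') -> h < s ->
    meeting r r' h s' -> ~ f n r' s').

(** Depth 0 lets every ray survive, so the iterates alternately overestimate and underestimate
    survival. They stabilise because chains of dependence are finite, not by monotonicity. *)
Fixpoint alive S n r (s : R) : Prop :=
  if n is m.+1 then forall r' h s', S (source r') -> h < s ->
    meeting r r' h s' -> ~ alive S m r' s' else True.

Lemma alive_recursive S : recursive S (alive S).
Proof. by []. Qed.

Lemma alive_le S n r (s s' : R) : s' <= s -> alive S n r s -> alive S n r s'.
Proof.
by case: n => //= n ss' a r' h s'' Sr' hs'; apply: a => //; apply: lt_le_trans ss'.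
Qed.

Lemma alive_local S S' n r s :
  (forall x, box (tip r s) s x.1 -> S x <-> S' x) ->
  alive S n r s <-> alive S' n r s.
Proof.
elim: n r s => //= n IH r s SS'.
have H r' h s' : h < s -> meeting r r' h s' ->
    (S (source r') <-> S' (source r')) /\ (alive S n r' s' <-> alive S' n r' s').
  move=> hs m; have sub := meeting_cone hs m; split.
    by apply/SS'/sub/source_box; case: m => /andP[].
  by apply: IH => x bx; apply: SS'; exact: sub.
split=> a r' h s' Sr' hs m; have [E1 E2] := H _ _ _ hs m.
  by rewrite -E2; apply: a hs m; apply/E1.
by rewrite E2; apply: a hs m; apply/E1.
Qed.

Lemma count_lt_threshold (C : seq R) (c s s' : R) : c \in C -> s' <= c -> c < s ->
  (count (fun x => x < s')%R C < count (fun x => x < s)%R C)%N.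
Proof.
move=> cC s'c cs; elim: C cC => //= x C IH; rewrite in_cons.
have le : (count (fun x => x < s')%R C <= count (fun x => x < s)%R C)%N.
  by apply: sub_count => y /= ys'; apply: lt_trans ys' (le_lt_trans s'c cs).
case/predU1P => [<-|/IH lt]; first by rewrite cs ltNge s'c.
have : ((x < s')%R <= (x < s)%R)%N.
  by case: (ltP x s') => // xs'; rewrite (lt_trans xs' (le_lt_trans s'c cs)).
by move=> h; rewrite -addnS leq_add.
Qed.

(* Along a meeting the times cross half the distance of the two sources, so the
   number of half-distances below the current time decreases. *)
Lemma recursive_unique S (K : set (R * R)) (C : seq R)
    (f g : nat -> @ray R -> R -> Prop) :
  (forall x y, S x -> S y -> K x.1 -> K y.1 -> dist1 x.1 y.1 / 2 \in C) ->
  recursive S f -> recursive S g ->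
  forall n m r s, S (source r) -> box (tip r s) s `<=` K ->
    (count (fun x => x < s)%R C < n)%N -> (count (fun x => x < s)%R C < m)%N ->
    f n r s <-> g m r s.
Proof.
move=> CP fP gP; elim=> // n IH [//|m] r s Sr sub; rewrite !ltnS => cn cm.
rewrite (fP _ _ _ Sr) (gP _ _ _ Sr).
suff H r' h s' : S (source r') -> h < s -> meeting r r' h s' ->
    f n r' s' <-> g m r' s'.
  by split=> a r' h s' Sr' hs mt; [rewrite -(H r' h s')|rewrite (H r' h s')] => //;
    exact: (a r' h s' Sr' hs mt).
move=> Sr' hs mt; have /andP[c1 c2] := meeting_half mt.
have sub' := meeting_cone hs mt.
have /andP[s'0 s'h] : 0 <= s' <= h by case: mt.
(* The half-distance of the two sources is a threshold in [[s', s)], even if [s' = h], since [h < s]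
   is strict. *)
have lt : (count (fun x => x < s')%R C < count (fun x => x < s)%R C)%N.
  apply: count_lt_threshold (CP _ _ Sr Sr' _ _) c1 (le_lt_trans c2 hs).
    by apply/sub/source_box; lra.
  by apply/sub/sub'/source_box.
by apply: IH => //; [exact: subset_trans sub|exact: leq_trans cn|exact: leq_trans cm].
Qed.

Definition locfin S := forall p a, finite_set [set x | S x /\ box p a x.1].

Lemma locfin_half S p a : locfin S -> exists C : seq R,
  forall x y, S x -> S y -> box p a x.1 -> box p a y.1 -> dist1 x.1 y.1 / 2 \in C.
Proof.
move=> /(_ p a) /finite_seqP [l lE].
have inl z : S z -> box p a z.1 -> z \in l.
  by move=> Sz bz; have : [set` l] z by rewrite -lE.
exists [seq dist1 x.1 y.1 / 2 | x <- l, y <- l] => x y Sx Sy bx bxy.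
by apply/allpairsP; exists (x, y); split=> //=; exact: inl.
Qed.

(** The limit of the approximations, written as a countable combination of them so that
    measurability passes to it. *)
Definition live S r s := exists N, forall n, (N <= n)%N -> alive S n r s.

Lemma live_le S r (s s' : R) : s' <= s -> live S r s -> live S r s'.
Proof. by move=> ss' [N NP]; exists N => n /NP; exact: alive_le. Qed.

Lemma live_local S S' r s :
  (forall x, box (tip r s) s x.1 -> S x <-> S' x) -> live S r s <-> live S' r s.
Proof.
by move=> SS'; split=> -[N NP]; exists N => n /NP; rewrite (alive_local n SS').
Qed.

Lemma live_recursive S : locfin S -> recursive S (fun=> live S).
Proof.
move=> /locfin_half lf _ r s Sr.
have [C CP] := lf (tip r s) s.
set N := (size C).+1.
have cN x : (count (fun y => y < x)%R C < N)%N by rewrite ltnS count_size.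
(* [recursive_unique] compares [alive] with itself at two depths: beyond the number of thresholds
   the depth is irrelevant, uniformly over the rays in the light cone. *)
have stab n r' s' : (N <= n)%N -> S (source r') ->
    box (tip r' s') s' `<=` box (tip r s) s -> alive S n r' s' <-> alive S N r' s'.
  move=> Nn Sr' sub.
  apply: (recursive_unique CP (alive_recursive (S := S)) (alive_recursive (S := S))) => //.
  by apply: leq_trans Nn; exact: cN.
have liveE r' s' : S (source r') ->
    box (tip r' s') s' `<=` box (tip r s) s -> live S r' s' <-> alive S N r' s'.
  move=> Sr' sub; split=> [[M MP]|a]; last by exists N => n Nn; apply/(stab n).
  by apply/(stab (maxn M N)); rewrite ?leq_maxr//; apply: MP; rewrite leq_maxl.
rewrite liveE// -(stab N.+1)//=.
split=> a r' h s' Sr' hs mt; have := a r' h s' Sr' hs mt;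
  by rewrite liveE//; exact: meeting_cone mt.
Qed.

Lemma live_unique S (Q : @ray R -> R -> Prop) : locfin S ->
  recursive S (fun=> Q) -> forall r s, S (source r) -> Q r s <-> live S r s.
Proof.
move=> lf QP r s Sr; have [C CP] := locfin_half (tip r s) s lf.
by apply: (recursive_unique CP QP (live_recursive lf) (n := (size C).+1)
  (m := (size C).+1)) => //; rewrite ltnS count_size.
Qed.

Definition hits S (Q : @ray R -> R -> Prop) r : set R := [set h | 0 <= h /\
  exists r' s', [/\ S (source r'), (source r').1 <> (source r).1, 0 <= s' <= h,
    Q r' s' & tip r' s' = tip r h]].

(** The downward closure of [Q] allows a redundant hit to be replaced by the earlier meeting that it
    implies. *)
Lemma le_hits S (Q : @ray R -> R -> Prop) r s :
  (forall r' s s', s' <= s -> Q r' s -> Q r' s') ->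
  (s%:E <= ereal_inf [set h%:E | h in hits S Q r])%E <->
  (forall r' h s', S (source r') -> h < s -> meeting r r' h s' -> ~ Q r' s').
Proof.
move=> Qle; split=> [le r' h s' Sr' hs mt Qr'|H].
  have [/andP[s0 s'h] neq e _] := mt.
  have : (s%:E <= h%:E)%E.
    apply: le_trans le _; apply: ereal_inf_lbound; exists h => //; split; first lra.
    by exists r', s'; rewrite s0.
  by rewrite lee_fin leNgt hs.
apply: le_ereal_inf_tmp => _ [h [h0 [r' [s' [Sr' neq s'h Qr' e]]]] <-].
rewrite lee_fin leNgt; apply/negP => hs.
have [h1 [s1 [mt h1h s1s]]] := meeting_of_hit s'h neq (esym e).
exact: (H r' h1 s1 Sr' (le_lt_trans h1h hs) mt (Qle _ _ _ s1s Qr')).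
Qed.

Lemma is_gilbertE S T : is_gilbert S T <-> forall r, S (source r) ->
  T r = ereal_inf [set h%:E | h in hits S (fun r' s => (s%:E <= T r')%E) r].
Proof.
have E r : [set t : R | 0 <= t /\ exists r' : ray,
    [/\ S (source r'), (source r').1 <> (source r).1 &
        segment T r' t (tip r t)]] = hits S (fun r' s => (s%:E <= T r')%E) r.
  apply/seteqP; split=> t /= [t0].
    by case=> r' [Sr' neq [s [st sT] e]]; split=> //; exists r', s.
  by case=> r' [s [Sr' neq st sT e]]; split=> //; exists r'; split=> //; exists s.
by split=> H r Sr; rewrite H// E.
Qed.

(** [gilbert] picks some evolution, or a default if there is none. Every evolution solves the
    recursion and so agrees with [live]; conversely the hits of [live] define an evolution, which
    rules out the default. *)
Lemma gilbert_live S r s : locfin S -> S (source r) ->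
  (s%:E <= gilbert S r)%E <-> live S r s.
Proof.
move=> lf; move: r s.
suff H T : is_gilbert S T -> forall r s, S (source r) ->
    (s%:E <= T r)%E <-> live S r s.
  rewrite /gilbert; case: xgetP => [T _ /H HT r s|none]; first exact: HT.
  pose T r := ereal_inf [set h%:E | h in hits S (live S) r].
  have TE r s : S (source r) -> (s%:E <= T r)%E <-> live S r s.
    move=> Sr; rewrite /T le_hits; last by move=> r' x y; exact: live_le.
    by rewrite (live_recursive lf 0 s Sr).
  exfalso; apply: (none T); apply/is_gilbertE => r Sr; rewrite {1}/T.
  congr (ereal_inf (image _ _)); apply/seteqP.
  by split=> t [t0 [r' [s [Sr' neq st sT e]]]]; split=> //; exists r', s; split=> //;
    apply/TE.
move=> /is_gilbertE TP r s; apply: (live_unique lf (Q := fun r s => (s%:E <= T r)%E)).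
move=> _ {}r {}s Sr; rewrite {1}TP// le_hits// => r' x y yx.
by apply: le_trans; rewrite lee_fin.
Qed.

Definition along (d : bool) p := if d then p.2 else p.1.

(* Places from which a ray of the direction orthogonal to that of [r] reaches,
   within time [e], the part of the line of [r] at distance [e] from [tip r z]. *)
Definition cell r (z e : R) : set (@seed R) := [set x |
  [/\ x.2 = ~~ (source r).2,
    `|along (source r).2 x.1 - along (source r).2 (tip r z)| <= e &
    0 < along (~~ (source r).2) x.1 - along (~~ (source r).2) (tip r z) <= e]].

Lemma cell_box r (z e : R) : cell r z e `<=` [set x | box (tip r z) (3 * e) x.1].
Proof.
move=> x [_]; rewrite /box /= /along /=.
by case: (source r).2 => /= /ler_normlP[? ?] /andP[? ?];
  split; apply/ler_normlP; split; lra.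
Qed.

Lemma finite_argmin (T : Type) (D : set T) (f : T -> R) : finite_set D ->
  D !=set0 -> exists2 x, D x & forall y, D y -> f x <= f y.
Proof.
move=> finD [x0 Dx0].
have /finite_seqP [l lE] := finite_image f finD.
have nl : f x0 \in l by have : [set` l] (f x0) by rewrite -lE; exists x0.
have : exists2 m, m \in l & forall y, y \in l -> m <= y.
  have {nl} : l != [::] by case: l nl {lE}.
  elim: l {lE} => // a [|b l] IH _.
    by exists a; rewrite ?mem_head// => y; rewrite inE => /eqP ->.
  have [m ml mP] := IH isT.
  case: (leP a m) => am.
    exists a; rewrite ?mem_head// => y; rewrite inE => /predU1P[->//|/mP].
    exact: le_trans.
  exists m; first by rewrite inE ml orbT.
  by move=> y; rewrite inE => /predU1P[->|/mP//]; exact: ltW.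
move=> [m ml mP]; have [x Dx xm] : (f @` D) m by rewrite lE.
exists x => // y Dy; rewrite xm; apply: mP.
by have : [set` l] (f y) by rewrite -lE; exists y.
Qed.

(* The lowest seed of the cell shoots a ray that nothing can stop before it
   reaches the line of [r]. *)
Lemma blocked S r (z e s : R) : locfin S -> S (source r) -> 2 * e <= z -> z + e < s ->
  (forall x, S x -> box (tip r z) (3 * e) x.1 -> cell r z e x) ->
  (exists2 x, S x & cell r z e x) -> ~ live S r s.
Proof.
move=> lf Sr ez zs Sc [x0 Sx0 cx0].
pose d := (source r).2.
pose height (x : @seed R) := along (~~ d) x.1 - along (~~ d) (tip r z).
have [|x [Sx bx] xmin] := @finite_argmin _ _ height (lf (tip r z) (3 * e)).
  by exists x0; split=> //; exact: cell_box.
have [xd xa /andP[h0 he]] := Sc _ Sx bx.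
have e0 : 0 < e by lra.
rewrite (live_recursive lf 0 s Sr).
pose r' := Ray x false.
(* The time at which [r] passes [x]. It differs from [z] by at most [e], so [2 * e <= z] gives
   [height x <= e <= h]: the ray [r'] is not late at the crossing. *)
pose h := sgn (sign r) * (along d x.1 - along d (source r).1).
have hz : `|h - z| <= e.
  move: xa; rewrite /h /d /along /tip.
  case: (source r) => [[a b] []]; case: (sign r) => /= /ler_normlP[? ?];
    by apply/ler_normlP; split; lra.
have /ler_normlP[hz1 hz2] := hz.
have e1 : tip r h = tip r' (height x).
  rewrite /tip /r' /= xd /h /height /d /along /tip.
  by case: (source r) => [[a b] []]; case: (sign r) => /=; congr (_, _); lra.
have neq : x.1 <> (source r).1.
  move=> ex; move: h0; rewrite /height ex /along /tip.
  by case: (source r) => [[a b] []] /=; lra.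
have hh : 0 <= height x <= h by rewrite /height /d; lra.
have [h1 [s1 [mt h1h s1s]]] := @meeting_of_hit r r' h (height x) hh neq e1.
have h1s : h1 < s by lra.
move=> /(_ r' h1 s1 Sx h1s mt); apply.
have Sr' : S (source r') := Sx.
rewrite (live_recursive lf 0 s1 Sr') => r'' h2 s2 Sr'' h2s mt'.
have [/andP[s20 s2h] neq'' e2 _] := mt'.
(* The tip of [r'] stays within [e] of [tip r z] and [s1 <= e], so whatever could stop [r'] starts
   within [2 * e]. *)
have cone : box (tip r z) (3 * e) (source r'').1.
  have c1 : box (tip r z) e (tip r' s1).
    have s10 : 0 <= s1 by case: mt => /andP[].
    move: xd xa h0 he s1s; rewrite /r' /height /box /tip /= => ->; rewrite /d /along.
    by case: (source r) => [[a b] []] /= /ler_normlP[? ?] ? ? ?;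
      split; apply/ler_normlP; split; lra.
  have [] := box_sub c1 (meeting_cone h2s mt' (source_box r'' s20)).
  by move=> p1 p2; split; [apply: le_trans p1 _|apply: le_trans p2 _];
    rewrite /height in s1s; lra.
have [xd'' xa'' /andP[h0'' he'']] := Sc _ Sr'' cone.
(* Being in the cell, the source of [r''] lies on the line of [r'], and it is no lower than [x]. As
   [s2 <= h2], the tips can agree only if both sources have the same position. *)
have := xmin _ (conj Sr'' cone); rewrite /height => hx.
move=> _; apply: neq''; move: e2 hx h0 h0''; rewrite /tip /r' /= xd xd'' /d /along.
move: (source r'').1 x.1 => [a b] [a' b'].
by case: (source r).2; case: (sign r'') => /= -[? ?] *; congr (_, _); lra.
Qed.

End Dynamics.

(** * Measurability of survival *)

Section ExistsMeasurable.
Context {R : realType}.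

Lemma measurable_ler d (T : measurableType d) (f g : T -> R) :
  measurable_fun setT f -> measurable_fun setT g -> measurable [set x | f x <= g x].
Proof.
move=> mf mg; have := measurable_fun_ler mf mg measurableT (Y := [set true]).
by rewrite setTI; apply.
Qed.

Lemma measurable_ltr d (T : measurableType d) (f g : T -> R) :
  measurable_fun setT f -> measurable_fun setT g -> measurable [set x | f x < g x].
Proof.
move=> mf mg; have := measurable_fun_ltr mf mg measurableT (Y := [set true]).
by rewrite setTI; apply.
Qed.

Lemma measurable_eqr d (T : measurableType d) (f g : T -> R) :
  measurable_fun setT f -> measurable_fun setT g -> measurable [set x | f x = g x].
Proof.
move=> mf mg; rewrite (_ : [set _ | _] = [set x | f x <= g x] `&` [set x | g x <= f x]).
  by apply: measurableI; exact: measurable_ler.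
apply/seteqP; split=> x /= => [->//|[a b]].
by apply/eqP; rewrite eq_le a b.
Qed.

Lemma measurable_bool_cases d (T : measurableType d) (f : T -> bool)
    (E : bool -> set T) : measurable_fun setT f -> (forall b, measurable (E b)) ->
  measurable [set x | E (f x) x].
Proof.
move=> mf mE; rewrite (_ : [set _ | _] =
    (f @^-1` [set true] `&` E true) `|` (f @^-1` [set false] `&` E false)).
  by apply: measurableU; apply: measurableI => //; rewrite -[_ @^-1` _]setTI; exact: mf.
apply/seteqP; split=> x /=; last by case=> -[->].
by case: (f x) => ?; [left|right].
Qed.

(** Half-open squares of side [1 / (n + 1)], for all [n] and both directions: a countable family
    that isolates every seed of a locally finite set. *)
Definition grid (k : nat * int * int * bool) : set (@seed R) := [set x |
  [/\ k.1.1.2%:~R <= k.1.1.1.+1%:R * x.1.1 < (k.1.1.2 + 1)%:~R,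
      k.1.2%:~R <= k.1.1.1.+1%:R * x.1.2 < (k.1.2 + 1)%:~R & x.2 = k.2]].

Lemma measurable_grid k : measurable (grid k).
Proof.
have m1 : measurable_fun setT (fun x : @seed R => x.1.1) by exact: measurableT_comp.
have m2 : measurable_fun setT (fun x : @seed R => x.1.2) by exact: measurableT_comp.
rewrite (_ : grid k = [set x | k.1.1.2%:~R <= k.1.1.1.+1%:R * x.1.1] `&`
  [set x | k.1.1.1.+1%:R * x.1.1 < (k.1.1.2 + 1)%:~R] `&`
  [set x | k.1.2%:~R <= k.1.1.1.+1%:R * x.1.2] `&`
  [set x | k.1.1.1.+1%:R * x.1.2 < (k.1.2 + 1)%:~R] `&` snd @^-1` [set k.2]).
  repeat apply: measurableI.
  - by apply: measurable_ler => //; exact: measurable_funM.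
  - by apply: measurable_ltr => //; exact: measurable_funM.
  - by apply: measurable_ler => //; exact: measurable_funM.
  - by apply: measurable_ltr => //; exact: measurable_funM.
  - by rewrite -[_ @^-1` _]setTI; exact: measurable_snd.
apply/seteqP; split=> x /=; first by case=> /andP[? ?] /andP[? ?].
by case=> -[[[? ?] ?] ?] ?; split=> //; apply/andP.
Qed.

Lemma isolating_grid (S : set (@seed R)) x : locfin S -> S x ->
  exists k, grid k x /\ forall y, S y -> grid k y -> y = x.
Proof.
move=> lf Sx.
(* The value 1 keeps the minimum positive; a seed at the position of [x] is told apart by its
   direction instead. *)
pose f (y : @seed R) : R := if y.1 == x.1 then 1 else `|y.1.1 - x.1.1| + `|y.1.2 - x.1.2|.
have [|m _ mP] := @finite_argmin _ _ _ f (lf x.1 1).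
  by exists x; split=> //; split; rewrite subrr normr0.
have fm : 0 < f m.
  rewrite /f; case: eqP => // neq; rewrite lt_neqAle addr_ge0// andbT eq_sym paddr_eq0//.
  rewrite !normr_eq0 !subr_eq0; apply/negP => /andP[/eqP e1 /eqP e2].
  by apply: neq; rewrite (surjective_pairing m.1) e1 e2; case: (x.1).
(* Two points of one square are at l1 distance at most [2 / (n + 1)]. *)
have [n nP] : exists n, 2 < n.+1%:R * f m.
  exists (Num.bound (2 / f m)); rewrite -ltr_pdivrMr//.
  apply: lt_le_trans (archi_boundP _) _; first by rewrite divr_ge0// ltW.
  by rewrite ler_nat.
exists (n, Num.floor (n.+1%:R * x.1.1), Num.floor (n.+1%:R * x.1.2), x.2).
split; first by split=> //=; exact: floor_itv.
move=> y Sy [/=]; set i := Num.floor _; set j := Num.floor _.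
have /andP[] : i%:~R <= n.+1%:R * x.1.1 < (i + 1)%:~R by exact: floor_itv.
have /andP[] : j%:~R <= n.+1%:R * x.1.2 < (j + 1)%:~R by exact: floor_itv.
rewrite !intrD => a1 a2 a3 a4 /andP[a5 a6] /andP[a7 a8] e.
have n1 : 1 <= n.+1%:R :> R by rewrite ler1n.
have b1 : n.+1%:R * `|y.1.1 - x.1.1| <= 1.
  rewrite -{1}(gtr0_norm (lt_le_trans ltr01 n1)) -normrM mulrBr ler_norml.
  by apply/andP; split; lra.
have b2 : n.+1%:R * `|y.1.2 - x.1.2| <= 1.
  rewrite -{1}(gtr0_norm (lt_le_trans ltr01 n1)) -normrM mulrBr ler_norml.
  by apply/andP; split; lra.
have fy : f m <= f y.
  by apply: mP; split=> //; split; [move: b1|move: b2]; apply: le_trans;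
    rewrite ler_peMl.
move: fy; rewrite {2}/f; case: eqP => [e1 _|_ fy].
  by move: e e1; rewrite (surjective_pairing y) (surjective_pairing x) /= => -> ->.
have {fy} := ler_wpM2l (le_trans ler01 n1) fy.
rewrite mulrDr => /(lt_le_trans nP); rewrite ltNge => /negP[]; exact: lerD b1 b2.
Qed.

Definition void {Omega : Type} (S : Omega -> set (@seed R)) (V : set (@seed R)) :
  set Omega := [set w | forall x, S w x -> ~ V x].

Definition voids {Omega : Type} (S : Omega -> set (@seed R)) (B : set (@seed R)) :
  set (set Omega) := [set void S V | V in [set V | measurable V /\ V `<=` B]].

Context {Omega : pointedType} (S : Omega -> set (@seed R)) (B : set (@seed R)).
Hypothesis locfinS : forall w, locfin (S w).

(** Projections do not preserve measurability in general; this one runs over a locally finite set.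
    The delicate case is the complement of [A]: in a square isolating a seed, to have a seed outside
    [A] means that the square is occupied and has no seed in [A]. The induction therefore ranges
    over all measurable [V] inside [B]. *)
Lemma measurable_exists dZ (Z : measurableType dZ)
    (om : Z -> g_sigma_algebraType (voids S B)) (A : set (@seed R * Z)) :
  measurable B -> measurable_fun setT om -> measurable A ->
  measurable [set z | exists x, [/\ S (om z) x, B x & A (x, z)]].
Proof.
move=> mB mom mA.
pose G : set (set (@seed R * Z)) := [set A | forall V, measurable V -> V `<=` B ->
  measurable [set z | exists x, [/\ S (om z) x, V x & A (x, z)]]].
suff : G A by move=> /(_ B mB); apply.
have mvoid V : measurable V -> V `<=` B -> measurable (om @^-1` void S V).
  move=> mV VB; rewrite -[_ @^-1` _]setTI; apply: mom => //.
  by apply: sub_sigma_algebra; exists V.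
move: A mA; rewrite measurable_prod_measurableType.
apply: smallest_sub; last first.
  move=> _ [A1 mA1 [A2 mA2 <-]] V mV VB.
  rewrite (_ : [set _ | _] = ~` (om @^-1` void S (V `&` A1)) `&` A2).
    apply: measurableI => //; apply: measurableC; apply: mvoid.
      exact: measurableI.
    by move=> x [/VB].
  apply/seteqP; split=> z /=.
    by case=> x [Sx Vx [? ?]]; split=> // /(_ _ Sx); apply.
  case=> + A2z => /existsNP[x /not_implyP[Sx /contrapT[Vx A1x]]].
  by exists x.
split.
- move=> V mV VB; rewrite (_ : [set _ | _] = set0)//.
  by apply/seteqP; split=> // z [x []].
- move=> A GA V mV VB; rewrite setTD.
  rewrite (_ : [set _ | _] = \bigcup_k (~` (om @^-1` void S (V `&` grid k)) `&`
    ~` [set z | exists x, [/\ S (om z) x, (V `&` grid k) x & A (x, z)]])).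
    apply: countable_bigcupT_measurable => // k.
    have mVk := measurableI _ _ mV (measurable_grid k).
    by apply: measurableI; apply: measurableC; [apply: mvoid|apply: GA] => // x [/VB].
  apply/seteqP; split=> z /=.
    case=> x [Sx Vx nA]; have [k [kx kP]] := isolating_grid (locfinS (om z)) Sx.
    exists k => //; split; first by move/(_ x Sx); apply.
    by case=> y [Sy [_ /(kP _ Sy) ->]].
  case=> k _ [/existsNP[x /not_implyP[Sx /contrapT[Vx kx]]] nA].
  by exists x; split=> // Ax; apply: nA; exists x.
- move=> F GF V mV VB; rewrite (_ : [set _ | _] = \bigcup_n
    [set z | exists x, [/\ S (om z) x, V x & F n (x, z)]]).
    by apply: bigcupT_measurable => n; exact: GF.
  apply/seteqP; split=> z /=; first by case=> x [Sx Vx [n _ Fx]]; exists n => //; exists x.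
  by case=> n _ [x [Sx Vx Fx]]; exists x; split=> //; exists n.
Qed.

End ExistsMeasurable.

(** * Explicit times of the meetings *)

Section Meetings.
Context {R : realType}.
Implicit Types r : @ray R.

Lemma meeting_perp r r' (h s : R) (d := (source r).2) : (source r').2 = ~~ d ->
  meeting r r' h s <->
  [/\ h = sgn (sign r) * (along d (source r').1 - along d (source r).1),
      s = sgn (sign r') * (along (~~ d) (source r).1 - along (~~ d) (source r').1),
      0 <= s <= h & (source r').1 <> (source r).1].
Proof.
rewrite /d; case: r r' {d} => [[[x y] d] b] [[[x' y'] d'] b'] /= ->.
rewrite /meeting /tip /dist1 /along /=; split.
  move=> [? ? [e1 e2] _]; split=> //; move: e1 e2;
    by case: d; case: b; case: b' => /=; lra.
move=> [-> -> /andP[h1 h2] neq].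
have e : `|x - x'| + `|y - y'| = sgn b * ((if d then y' else x') - (if d then y else x))
   + sgn b' * ((if ~~ d then y else x) - (if ~~ d then y' else x')).
  move: h1 h2 {neq}; case: d; case: b; case: b' => /=; 
    by case: (ger0P (x - x')) => ?; case: (ger0P (y - y')) => ?; lra.
split=> //; first by rewrite h1.
by move: e {neq h1 h2}; case: d; case: b; case: b' => /= _; congr (_, _); lra.
Qed.

(** Unlike for perpendicular rays, [h] and [s] are not determined when two rays face each other: the
    tip of [r] may touch the trail of [r'] at any [h] between [l / 2] and [l]. *)
Lemma meeting_par r r' (h s : R) (d := (source r).2)
    (l := sgn (sign r) * (along d (source r').1 - along d (source r).1)) :
  (source r').2 = d -> meeting r r' h s <->
  [/\ 0 <= s <= h, along (~~ d) (source r').1 = along (~~ d) (source r).1, 0 < l,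
      h + s = l & (sign r' = sign r -> s = 0)].
Proof.
rewrite /l /d; case: r r' {l d} => [[[x y] d] b] [[[x' y'] d'] b'] /= ->.
rewrite /meeting /tip /dist1 /along /=; split.
  move=> [/andP[s0 sh] neq [e1 e2] e3].
  have h0 : 0 < h.
    rewrite lt_neqAle (le_trans s0 sh) andbT; apply/eqP => h0; apply: neq.
    have s00 : s = 0 by lra.
    by move: e1 e2; rewrite s00 -h0 !mulr0 !mul0r !addr0 => -> ->.
  rewrite s0 sh; move: e1 e2 e3 {neq}.
  case: d; case: b; case: b' => /=;
   case: (ger0P (x - x')) => ?; case: (ger0P (y - y')) => ?; by split=> // *; lra.
move=> [/andP[s0 sh] e l0 e1 e2].
have {}e2 : b' = b -> s = 0 := e2.
split; first by rewrite s0.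
- move=> [exx ey]; move: l0; rewrite exx ey; case: (d) => /=; lra.
- move: e l0 e1 e2; case: d; case: b; case: b' => /= e l0 e1 e2;
  by congr (_, _); try (have := e2 erefl); lra.
- move: e l0 e1 {e2}; case: d; case: b => /= e l0 e1;
   by case: (ger0P (x - x')) => ?; case: (ger0P (y - y')) => ?; lra.
Qed.

End Meetings.

Section AliveMeasurable.
Context {R : realType} {Omega : pointedType} (S : Omega -> set (@seed R)).
Context (B : set (@seed R)) (a : @seed R).
Hypotheses (locfinS : forall w, locfin (S w)) (mB : measurable B).

Let O := g_sigma_algebraType (voids S B).

Definition observed (w : Omega) : set (@seed R) := (S w `&` B) `|` [set a].

(** Source, sign, time and configuration: the induction on the depth needs measurability jointly in
    all of them. *)
Let Z : Type := (@seed R * bool * R * O)%type.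
Let T : Type := (@seed R * Z)%type.

Let alive_set n : set Z :=
  [set z | alive (observed z.2) n (Ray z.1.1.1 z.1.1.2) z.1.2].

(* The ray with source [t.1] and sign [b'], if alive, stops the ray in [t.2]. *)
Let hit_set n (b' : bool) : set T := [set t | exists h s', [/\ h < t.2.1.2,
  meeting (Ray t.2.1.1.1 t.2.1.1.2) (Ray t.1 b') h s' &
  alive_set n (t.1, b', s', t.2.2)]].

Let gap (d b : bool) (t : T) : R := sgn b * (along d t.1.1 - along d t.2.1.1.1.1).

Let measurable_along1 d : measurable_fun setT (fun t : T => along d t.1.1).
Proof. by rewrite /along; case: d; do 2! apply: measurableT_comp => //. Qed.

Let measurable_along2 d : measurable_fun setT (fun t : T => along d t.2.1.1.1.1).
Proof. by rewrite /along; case: d; do 5! apply: measurableT_comp => //. Qed.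

Let measurable_gap d b : measurable_fun setT (gap d b).
Proof. by apply: measurable_funM => //; exact: measurable_funB. Qed.

Let measurable_time : measurable_fun setT (fun t : T => t.2.1.2).
Proof. by do 2! apply: measurableT_comp => //. Qed.

Let measurable_alive_comp n b' (f : T -> R) : measurable_fun setT f ->
  measurable (alive_set n) ->
  measurable [set t : T | alive_set n (t.1, b', f t, t.2.2)].
Proof.
move=> mf mA; rewrite -[X in measurable X]setTI.
have : measurable_fun setT (fun t : T => (t.1, b', f t, t.2.2) : Z).
  apply: measurable_fun_pair; last exact: measurableT_comp.
  by apply: measurable_fun_pair => //; exact: measurable_fun_pair.
by move=> /(_ measurableT _ mA).
Qed.

Let perp_set n b d b' : set T := [set t | [/\ 0 <= - gap (~~ d) b' t,
  - gap (~~ d) b' t <= gap d b t, gap d b t < t.2.1.2, t.1.1 <> t.2.1.1.1.1 &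
  alive_set n (t.1, b', - gap (~~ d) b' t, t.2.2)]].

(** Either [r] passes the source of [r'] in time, or the rays face each other. In the second case
    rational times suffice: a later [h] means an earlier [s'], and [alive] is downward closed in
    time. *)
Let par_set n b d b' : set T := [set t | [/\ 0 < gap d b t,
  along (~~ d) t.1.1 = along (~~ d) t.2.1.1.1.1 &
  gap d b t < t.2.1.2 \/ b' <> b /\ exists q : rat,
    [/\ gap d b t / 2 <= ratr q, ratr q <= gap d b t, ratr q < t.2.1.2 &
       alive_set n (t.1, b', gap d b t - ratr q, t.2.2)]]].

Let hit_setE n b' t : hit_set n b' t <->
  (if t.1.2 == t.2.1.1.1.2 then par_set n t.2.1.1.2 t.2.1.1.1.2 b'
   else perp_set n t.2.1.1.2 t.2.1.1.1.2 b') t.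
Proof.
case: t => x [[[y b] s] w]; rewrite /hit_set /par_set /perp_set /gap /=.
case: eqP => [e|/eqP e].
  split.
    move=> [h [s' [hs]]]; rewrite meeting_par//= => -[/andP[s0 sh] ea l0 hsl sb].
    set l := sgn b * _ in l0 hsl *; move=> al; split=> //.
    have [ls|sl] := ltP l s; first by left.
    right; split; first by move=> /sb s'0; move: hsl sl hs; rewrite s'0; lra.
    have [q] := rat_in_itvoo hs; rewrite in_itv /= => /andP[hq qs].
    exists q; split; [lra|lra|by []|].
    by apply: alive_le al; rewrite /=; lra.
  move=> [l0 ea]; set l := sgn b * _ in l0 * => H.
  have [ls|sl] := ltP l s.
    exists l, 0; split=> //; first by rewrite meeting_par//= lexx addr0 (ltW l0).
    by rewrite /alive_set; case: (n) => //= m r' h s' _ h0 [/andP[? ?] _ _ _] _; lra.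
  case: H => [|[bb [q [q1 q2 q3 q4]]]]; first by rewrite ltNge sl.
  exists (ratr q), (l - ratr q); split=> //; rewrite meeting_par//= -/l; split=> //.
    by apply/andP; split; lra.
  lra.
have {}e : x.2 = ~~ y.2 by move: e; case: x.2; case: y.2.
have E : - (sgn b' * (along (~~ y.2) x.1 - along (~~ y.2) y.1)) =
  sgn b' * (along (~~ y.2) y.1 - along (~~ y.2) x.1) by rewrite -mulrN opprB.
rewrite /= E; split.
  by move=> [h [s' [hs]]]; rewrite meeting_perp//= => -[<- <- /andP[? ?] ?] ?.
move=> [? ? ? ? ?]; eexists; eexists; split; last eassumption; first eassumption.
by rewrite meeting_perp//=; split=> //; apply/andP.
Qed.

Let measurable_hit_set n b' : measurable (alive_set n) -> measurable (hit_set n b').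
Proof.
move=> mA.
have mperp b d : measurable (perp_set n b d b').
  have mg : measurable_fun setT (fun t => - gap (~~ d) b' t) by exact: measurableT_comp.
  rewrite (_ : perp_set n b d b' = [set t | 0 <= - gap (~~ d) b' t] `&`
    [set t | - gap (~~ d) b' t <= gap d b t] `&` [set t | gap d b t < t.2.1.2] `&`
    ~` ([set t | along false t.1.1 = along false t.2.1.1.1.1] `&`
        [set t | along true t.1.1 = along true t.2.1.1.1.1]) `&`
    [set t | alive_set n (t.1, b', - gap (~~ d) b' t, t.2.2)]).
    apply: measurableI; last exact: measurable_alive_comp.
    apply: measurableI; last first.
      by apply: measurableC; apply: measurableI; exact: measurable_eqr.
    apply: measurableI; last exact: measurable_ltr.
    by apply: measurableI; exact: measurable_ler.
  apply/seteqP; split=> t /=.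
    move=> [? ? ? neq ?]; split=> //; split=> // -[e1 e2]; apply: neq.
    by rewrite (surjective_pairing t.1.1) [RHS]surjective_pairing; congr (_, _).
  by move=> [[[[? ?] ?] neq] ?]; split=> // e; apply: neq; rewrite /along e.
have mpar b d : measurable (par_set n b d b').
  rewrite (_ : par_set n b d b' = [set t | 0 < gap d b t] `&`
    [set t | along (~~ d) t.1.1 = along (~~ d) t.2.1.1.1.1] `&`
    ([set t | gap d b t < t.2.1.2] `|` ([set t : T | b' <> b] `&`
      \bigcup_(q : rat) ([set t | gap d b t / 2 <= ratr q] `&`
        [set t | ratr q <= gap d b t] `&` [set t : T | ratr q < t.2.1.2] `&`
        [set t | alive_set n (t.1, b', gap d b t - ratr q, t.2.2)])))).
    apply: measurableI; first by apply: measurableI;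
      [exact: measurable_ltr|exact: measurable_eqr].
    apply: measurableU; first exact: measurable_ltr.
    apply: measurableI.
      case: (eqVneq b' b) => [->|/eqP bb].
        by rewrite (_ : [set _ | _] = set0)//; apply/seteqP; split.
      by rewrite (_ : [set _ | _] = setT)//; apply/seteqP; split.
    apply: bigcupT_measurable_rat => q; apply: measurableI; last first.
      by apply: measurable_alive_comp => //; exact: measurable_funB.
    apply: measurableI; last exact: measurable_ltr.
    by apply: measurableI; apply: measurable_ler => //; exact: measurable_funM.
  apply/seteqP; split=> t /=.
    move=> [? ? H]; split=> //; case: H => [|[? [q [? ? ? ?]]]]; [by left|right].
    by split=> //; exists q.
  move=> [[? ?] H]; split=> //; case: H => [|[? [q _ [[[? ?] ?] ?]]]]; [by left|right].
  by split=> //; exists q.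
pose E b d d' := if d' == d then par_set n b d b' else perp_set n b d b'.
rewrite (_ : hit_set n b' = [set t | E t.2.1.1.2 t.2.1.1.1.2 t.1.2 t]).
  apply: (@measurable_bool_cases _ T (fun t => t.2.1.1.2)
    (fun b => [set t | E b t.2.1.1.1.2 t.1.2 t])).
    by do 3! apply: measurableT_comp => //.
  move=> b; apply: (@measurable_bool_cases _ T (fun t => t.2.1.1.1.2)
    (fun d => [set t | E b d t.1.2 t])).
    by do 4! apply: measurableT_comp => //.
  move=> d; apply: (@measurable_bool_cases _ T (fun t => t.1.2) (E b d)).
    exact: measurableT_comp.
  by move=> d'; rewrite /E; case: ifP.
by apply/seteqP; split=> t /hit_setE.
Qed.

Lemma measurable_alive_set n : measurable (alive_set n).
Proof.
elim: n => [|n IH].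
  by rewrite (_ : alive_set 0 = setT)//; apply/seteqP; split.
have mh b' := measurable_hit_set b' IH.
have ms : measurable_fun setT (snd : Z -> O) by [].
have ma b' : measurable [set z : Z | hit_set n b' (a, z)].
  rewrite -[X in measurable X]setTI.
  have : measurable_fun setT (fun z : Z => (a, z) : T) by exact: measurable_fun_pair.
  by move=> /(_ measurableT _ (mh b')).
rewrite (_ : alive_set n.+1 = ~`
  (([set z | exists x, [/\ S z.2 x, B x & hit_set n true (x, z)]] `|`
    [set z | hit_set n true (a, z)]) `|`
   ([set z | exists x, [/\ S z.2 x, B x & hit_set n false (x, z)]] `|`
    [set z | hit_set n false (a, z)]))).
  by apply: measurableC; apply: measurableU; apply: measurableU => //;
    exact: (measurable_exists locfinS mB ms (mh _)).
have H z : ~ alive_set n.+1 z <-> exists b' x, observed z.2 x /\ hit_set n b' (x, z).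
  split.
    move=> /existsNP[[x b'] /existsNP[h /existsNP[s' /not_implyP[Sx
      /not_implyP[hs /not_implyP[mt /contrapT al]]]]]].
    by exists b', x; split=> //; exists h, s'.
  move=> [b' [x [Sx [h [s' [hs mt al]]]]]] /(_ (Ray x b') h s' Sx hs mt).
  exact.
apply/seteqP; split=> z /=.
  move=> al; apply: contraPnot al => K; apply/H.
  by case: K => -[[x [Sx Bx hx]]|hx];
    [exists true, x|exists true, a|exists false, x|exists false, a]; split=> //;
    (try by left); right.
move=> K; apply: contrapT => /H [b' [x [[[Sx Bx]|->] hx]]]; apply: K.
  by case: b' hx => hx; [left|right]; left; exists x.
by case: b' hx => hx; [left|right]; right.
Qed.

Lemma measurable_live r (s : R) :
  <<s voids S B >> [set w | live (observed w) r s].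
Proof.
rewrite (_ : [set _ | _] = \bigcup_N \bigcap_n
   [set w | (N <= n)%N -> alive (observed w) n r s]); last first.
  apply/seteqP; split=> w /=; first by move=> [N NP]; exists N => // n _; exact: NP.
  by move=> [N _ NP]; exists N => n; exact: NP.
suff m n : (@measurable _ O) [set w | alive (observed w) n r s].
  suff : (@measurable _ O) (\bigcup_N \bigcap_n
     [set w | (N <= n)%N -> alive (observed w) n r s]) by [].
  apply: bigcupT_measurable => N; apply: bigcapT_measurable => n.
  have [Nn|nN] := leqP N n.
    rewrite (_ : [set _ | _] = [set w | alive (observed w) n r s]) ?Nn//.
    by apply/seteqP; split=> w /= => [/(_ isT)|].
  by rewrite (_ : [set _ | _] = setT)//; apply/seteqP; split=> w /=.
rewrite -[X in measurable X]setTI.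
have : measurable_fun setT (fun w : O => (source r, sign r, s, w) : Z).
  exact: measurable_fun_pair.
by move=> /(_ measurableT _ (measurable_alive_set n)); rewrite /alive_set; case: (r).
Qed.

End AliveMeasurable.

(** * Independence *)

Section Independence.
Context {d} {Omega : measurableType d} {R : realType} (P : probability Omega R).
Local Open Scope ereal_scope.

(** In [E], both sides are finite measures, the restriction of [P] to [F] and a multiple of [P],
    that agree on a generator stable under intersection. *)
Lemma independent_generated (G : set (set Omega)) (F : set Omega) :
  G `<=` measurable -> setI_closed G -> G setT -> measurable F ->
  (forall E, G E -> P (E `&` F) = P E * P F) ->
  forall E, <<s G >> E -> P (E `&` F) = P E * P F.
Proof.
move=> Gm GI GT mF H E GE.
have pF : (0 <= fine (P F))%R by rewrite fine_ge0.
have PF : P F = (NngNum pF)%:num%:E by rewrite fineK// fin_num_measure.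
suff : mrestr P mF E = mscale (NngNum pF) P E.
  by rewrite /mrestr /mscale -PF => ->; rewrite muleC.
apply: (g_sigma_algebra_measure_unique G Gm (fun=> setT)) => //.
- by apply/seteqP; split=> // x _; exists 0%N.
- by move=> A GA; rewrite /= /mrestr /mscale -PF muleC; exact: H.
- by move=> _; rewrite /= /mrestr setTI ltey_eq fin_num_measure.
Qed.

Lemma setI_closed_voids (S : Omega -> set (@seed R)) B : setI_closed (voids S B).
Proof.
move=> _ _ [V [mV VB] <-] [W [mW WB] <-]; exists (V `|` W).
  by split; [exact: measurableU|move=> x [/VB|/WB]].
apply/seteqP; split=> w /=.
  by move=> H; split=> x Sx ?; apply: (H x Sx); [left|right].
by move=> [H1 H2] x Sx [/(H1 _ Sx)|/(H2 _ Sx)].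
Qed.

Lemma voids_setT (S : Omega -> set (@seed R)) B : voids S B setT.
Proof.
exists set0; first by split; [exact: measurable0|move=> x []].
by apply/seteqP; split=> // w _ x _ [].
Qed.

Lemma independent_voids (S : Omega -> set (@seed R)) (B B' : set (@seed R)) :
  (forall V, measurable V -> measurable (void S V)) ->
  (forall V W, measurable V -> measurable W -> V `<=` B -> W `<=` B' ->
    P (void S V `&` void S W) = P (void S V) * P (void S W)) ->
  forall E F, <<s voids S B >> E -> <<s voids S B' >> F -> P (E `&` F) = P E * P F.
Proof.
move=> mvoid H E F GE GF.
have mG C : voids S C `<=` measurable by move=> _ [V [mV _] <-]; exact: mvoid.
have msG C : <<s voids S C >> `<=` measurable.
  by apply: smallest_sub; [exact: sigma_algebra_measurable|exact: mG].
rewrite setIC muleC.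
apply: (independent_generated (mG B') (@setI_closed_voids S B') (voids_setT S B') _ _ GF).
  exact: msG GE.
move=> _ [W [mW WB'] <-]; rewrite setIC muleC.
apply: (independent_generated (mG B) (@setI_closed_voids S B) (voids_setT S B) _ _ GE).
  exact: mvoid.
by move=> _ [V [mV VB] <-]; exact: H.
Qed.

Lemma probability_eq_full (W E F : set Omega) : measurable W -> P W = 1 ->
  measurable E -> measurable F -> E `&` W = F `&` W -> P E = P F.
Proof.
move=> mW PW mE mF EF.
have nW : P (~` W) = 0 by rewrite probability_setC// PW subee.
have H A : measurable A -> P (A `&` W) = P A.
  move=> mA; have e : P A = P (A `\` W) + P (A `&` W) := measureDI P mA mW.
  suff z : P (A `\` W) = 0 by rewrite e z add0e.
  apply: (subset_measure0 _ _ _ nW); [exact: measurableD|exact: measurableC|].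
  by move=> x [].
by rewrite -H// EF H.
Qed.

(** [E] lies between the measurable events [F] intersected with [W] and [F] united with the
    complement of [W], which have the same probability. *)
Lemma outer_eq_full (W E F : set Omega) : measurable W -> P W = 1 ->
  measurable F -> E `&` W = F `&` W -> (P^*)%mu E = P F.
Proof.
move=> mW PW mF EF.
have mFW := measurableI _ _ mF mW; have mWC := measurableC mW.
have PFW : P (F `&` W) = P F.
  by apply: (probability_eq_full mW PW) => //; rewrite -setIA setIid.
have PFW' : P (F `|` ~` W) = P F.
  apply: (probability_eq_full mW PW) => //; first exact: measurableU.
  by rewrite setIUl setICl setU0.
apply/eqP; rewrite eq_le; apply/andP; split.
  rewrite -PFW' -(measurable_mu_extE _ (measurableU _ _ mF mWC)).
  apply: le_mu_ext => x Ex; have [Wx|nWx] := pselect (W x); last by right.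
  by left; suff [] : (F `&` W) x by []; rewrite -EF.
rewrite -PFW -(measurable_mu_extE _ mFW); apply: le_mu_ext.
by rewrite -EF => x [].
Qed.

End Independence.

(** * Probability that a set contains no marked point *)

Section Thinning.
Local Open Scope card_scope.
Context {R : realType} {lambda : R} {d : measure_display} {Omega : measurableType d}.
Context {P : probability Omega R} {X : nat -> Omega -> R * R} {D : nat -> Omega -> bool}.
Hypothesis MP : marked_poisson lambda P X D.
Local Open Scope ereal_scope.

Lemma sum_exp_coeff (x : R) : \sum_(k <oo) ((x ^+ k / k`!%:R)%R)%:E = (expR x)%:E.
Proof.
rewrite /expR -EFin_lim; last exact: is_cvg_series_exp_coeff.
by congr (limn _); apply/funext => n /=; rewrite sumEFin.
Qed.

Lemma partition_scale (T : finType) (f : Omega -> T) (A B : set Omega) (c : R) :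
  (forall t, measurable (f @^-1` [set t])) -> measurable A -> measurable B ->
  (forall t, P (A `&` f @^-1` [set t]) = c%:E * P (B `&` f @^-1` [set t])) ->
  P A = c%:E * P B.
Proof.
move=> mf mA mB H.
have E C : measurable C -> P C = \sum_(t \in [set: T]) P (C `&` f @^-1` [set t]).
  move=> mC; have e : C = \bigcup_(t in [set: T]) (C `&` f @^-1` [set t]).
    by apply/seteqP; split=> [w Cw|w [t _ []]]//; exists (f w).
  rewrite {1}e; apply: (measure_fin_bigcup P).
  - exact: finite_finset.
  - by move=> s t _ _ [w [[_ <-] [_ <-]]].
  - by move=> t _; exact: measurableI.
rewrite (E A mA) (E B mB) ge0_mule_fsumr; last by move=> t; exact: measure_ge0.
by apply: eq_fsbigr => t _; exact: H.
Qed.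

Let GT := g_sigma_algebraType (\bigcup_i preimage_set_system setT (X i) measurable).

Let sigma_points_measurable E : sigma_points X E -> measurable E.
Proof.
move: E; apply: smallest_sub; first exact: sigma_algebra_measurable.
move=> _ [i _ [C mC <-]]; exact: (mp_measurable_points MP).
Qed.

Lemma sigma_points_preimage C i : measurable C -> sigma_points X [set w | C (X i w)].
Proof.
by move=> mC; apply: sub_sigma_algebra; exists i => //; exists C; rewrite ?setTI.
Qed.

(** [mp_dirs] prescribes all directions of an initial segment of indices. An index missing from [J]
    is added with either direction and the two probabilities are summed; [m] bounds the indices that
    may still be missing. *)
Lemma dirs_subset (E : set Omega) (n m : nat) (J : pred nat) (b : nat -> bool) :
  sigma_points X E -> (m <= n)%N -> (forall i, (m <= i < n)%N -> J i) ->
  P (E `&` [set w | forall i, (i < n)%N -> J i -> D i w = b i]) =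
  ((2^-1)%R ^+ count J (iota 0 n))%:E * P E.
Proof.
move=> sE; have mE := sigma_points_measurable sE.
elim: m J b => [|m IH] J b mn Jm.
  rewrite (_ : [set w | _] = \bigcap_(i in `I_n) [set w | D i w = b i]); last first.
    apply/seteqP; split=> w /= H i; first by move=> ni; apply: H => //; exact: Jm.
    by move=> ni _; exact: H.
  rewrite (mp_dirs MP)// muleC (_ : count J (iota 0 n) = n)//.
  rewrite (eq_in_count (a2 := predT)) ?count_predT ?size_iota// => i.
  by rewrite mem_iota /= add0n => /Jm ->.
have [Jmm|nJm] := boolP (J m).
  apply: IH; first exact: ltnW.
  move=> i /andP[]; rewrite leq_eqVlt => /predU1P[<-//|mi ni].
  by apply: Jm; rewrite mi.
pose J' i := J i || (i == m).
pose b' v i := if i == m then v else b i.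
have J'm i : (m <= i < n)%N -> J' i.
  move=> /andP[]; rewrite leq_eqVlt /J' => /predU1P[<-|mi ni]; first by rewrite eqxx orbT.
  by rewrite Jm ?mi.
have cJ' : count J' (iota 0 n) = (count J (iota 0 n)).+1.
  have := count_predUI J (pred1 m) (iota 0 n).
  rewrite (_ : count (predI J (pred1 m)) _ = 0%N); last first.
    rewrite -[RHS](count_pred0 (iota 0 n)); apply: eq_count => i /=.
    by case: eqP => [->|_]; rewrite ?(negPf nJm) ?andbF.
  by rewrite count_uniq_mem ?iota_uniq// mem_iota /= add0n mn addn0 addn1.
have mDb v : measurable [set w | forall i, (i < n)%N -> J' i -> D i w = b' v i].
  rewrite (_ : [set w | _] = \bigcap_i
     (if (i < n)%N && J' i then [set w | D i w = b' v i] else setT)).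
    apply: bigcapT_measurable => i; case: ifP => // _.
    have := mp_measurable_dirs MP i measurableT (Y := [set b' v i]).
    by rewrite setTI; apply.
  apply/seteqP; split=> w /= H i; first by move=> _; case: ifP => // /andP[? ?]; exact: H.
  by move=> ni Ji; have := H i I; rewrite ni Ji.
pose F v := E `&` [set w | forall i, (i < n)%N -> J' i -> D i w = b' v i].
have -> : E `&` [set w | forall i, (i < n)%N -> J i -> D i w = b i] = F true `|` F false.
  apply/seteqP; split=> w /=.
    move=> [Ew H]; case Dm: (D m w); [left|right]; split=> // i ni; rewrite /J' /b';
    by case: eqP => [->|_]; rewrite ?orbF => // Ji; exact: H.
  by case=> -[Ew H]; split=> // i ni Ji; move: (H i ni); rewrite /J' /b' Ji;
    (case: eqP => [e|_]; [move: nJm; rewrite -e Ji|exact]).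
have -> : P (F true `|` F false) = P (F true) + P (F false).
  apply: (measureU P); [exact: measurableI|exact: measurableI|].
  apply/seteqP; split=> // w [[_ /(_ m mn)] + [_ /(_ m mn)]].
  by rewrite /J' /b' eqxx orbT => -> // /(_ isT).
rewrite /F !IH//; try exact: ltnW.
rewrite cJ' exprS -ge0_muleDl ?lee_fin ?mulr_ge0 ?exprn_ge0 ?invr_ge0//.
by rewrite -EFinD; congr (_%:E * _); field.
Qed.

Definition indices (C : set (R * R)) (w : Omega) : set nat := [set i | C (X i w)].

Definition counted (C : set (R * R)) (k : nat) : set Omega :=
  [set w | indices C w #= `I_k].

Definition bounded_by (C : set (R * R)) (n : nat) : set Omega :=
  [set w | forall i, (n <= i)%N -> ~ C (X i w)].

(** With [C] the places where exactly one direction is forbidden and [V] those where [false] is,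
    every point of [C] has its allowed direction. *)
Definition marked (C V : set (R * R)) : set Omega :=
  [set w | forall i, C (X i w) -> D i w = `[< V (X i w) >]].

Let pattern C V n w : n.-tuple (bool * bool) :=
  [tuple (`[< C (X i w) >], `[< V (X i w) >]) | i < n].

Let patternP C V n (s : n.-tuple (bool * bool)) w :
  pattern C V n w = s <-> forall i, (i < n)%N ->
    nth (false, false) s i = (`[< C (X i w) >], `[< V (X i w) >]).
Proof.
split=> [<- i ni|H]; first by rewrite (nth_mktuple _ _ (Ordinal ni)).
apply/val_inj/(@eq_from_nth _ (false, false)); first by rewrite !size_tuple.
move=> i; rewrite size_tuple => ni.
by rewrite [RHS]H//= (nth_mktuple _ _ (Ordinal ni)).
Qed.

Let sigma_pattern C V n s : measurable C -> measurable V ->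
  sigma_points X (pattern C V n @^-1` [set s]).
Proof.
move=> mC mV.
have mb C' i v : measurable C' -> sigma_points X [set w | `[< C' (X i w) >] = v].
  move=> mC'; have sp := sigma_points_preimage i mC'.
  case: v.
    rewrite (_ : [set w | _] = [set w | C' (X i w)])//.
    by apply/seteqP; split=> w /= /asboolP.
  rewrite (_ : [set w | _] = ~` [set w | C' (X i w)]).
    exact: (@measurableC _ GT).
  by apply/seteqP; split=> w /= => [/negbT/asboolPn|/asboolPn/negbTE].
rewrite (_ : _ @^-1` _ = \bigcap_i (if (i < n)%N then
    [set w | `[< C (X i w) >] = (nth (false, false) s i).1] `&`
    [set w | `[< V (X i w) >] = (nth (false, false) s i).2] else setT)).
  apply: (@bigcapT_measurable _ GT) => i; case: ifP => _.
    by apply: (@measurableI _ GT); exact: mb.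
  exact: (@measurableT _ GT).
apply/seteqP; split=> w /=.
  by move/patternP=> H i _; case: ifP => // /H /= ->.
move=> H; apply/patternP => i ni; move: (H i I); rewrite ni => -[/= -> ->].
by case: nth.
Qed.

Let sigma_bounded C n : measurable C -> sigma_points X (bounded_by C n).
Proof.
move=> mC; rewrite (_ : bounded_by C n = \bigcap_i
   (if (n <= i)%N then ~` [set w | C (X i w)] else setT)).
  apply: (@bigcapT_measurable _ GT) => i; case: ifP => _; last exact: (@measurableT _ GT).
  by apply: (@measurableC _ GT); exact: sigma_points_preimage.
apply/seteqP; split=> w /= H i; first by move=> _; case: ifP => // /H.
by move=> ni; have := H i I; rewrite ni.
Qed.

Let pcount n (s : n.-tuple (bool * bool)) :=
  count (fun i => (nth (false, false) s i).1) (iota 0 n).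

Let counted_pattern C V n k w : bounded_by C n w ->
  counted C k w <-> pcount (pattern C V n w) = k.
Proof.
move=> bw; pose J i := (nth (false, false) (pattern C V n w) i).1.
have JE i : (i < n)%N -> J i <-> C (X i w).
  by move=> ni; rewrite /J (nth_mktuple _ _ (Ordinal ni)) /=; split=> /asboolP.
pose A := [fset i in [seq i <- iota 0 n | J i]]%fset.
have AE : indices C w = [set` A].
  apply/seteqP; split=> i /=; rewrite !inE mem_filter mem_iota /= add0n.
    move=> Ci; have ni : (i < n)%N by rewrite ltnNge; apply/negP => /bw.
    by rewrite ni andbT; apply/JE.
  by move=> /andP[Ji /JE[+ _]]; apply.
have cA : #|` A|%fset = pcount (pattern C V n w).
  by rewrite card_fseq undup_id ?filter_uniq ?iota_uniq// size_filter.
by rewrite /counted /= AE -cA; split=> /card_eq_fsetP.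
Qed.

Let finite_bounded C w : finite_set (indices C w) -> exists n, bounded_by C n w.
Proof.
move=> /finite_seqP[s sE]; exists (\max_(i <- s) i).+1 => i ni Ci.
have : i \in s by have : [set` s] i by rewrite -sE.
by move=> si; have := leq_bigmax_seq (P := predT) (F := id) _ si isT; rewrite /= leqNgt ni.
Qed.

Let sigma_counted C k : measurable C -> sigma_points X (counted C k).
Proof.
move=> mC; rewrite (_ : counted C k = \bigcup_n \bigcup_(s in
    [set s : n.-tuple (bool * bool) | pcount s = k])
    (bounded_by C n `&` pattern C C n @^-1` [set s])).
  apply: (@bigcupT_measurable _ GT) => n.
  apply: (@fin_bigcup_measurable _ GT); first exact: finite_finset.
  by move=> s _; apply: (@measurableI _ GT); [exact: sigma_bounded|exact: sigma_pattern].
apply/seteqP; split=> w /=.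
  move=> cw; have [n bn] : exists n, bounded_by C n w.
    by apply: finite_bounded; apply/finite_setP; exists k.
  by exists n => //; exists (pattern C C n w) => //=; apply/(counted_pattern _ _ bn).
by case=> n _ [s /= sk [bw ps]]; apply/(counted_pattern C k bw); rewrite ps.
Qed.

Let measurable_marked C V : measurable C -> measurable V -> measurable (marked C V).
Proof.
move=> mC mV.
have mD i v : measurable [set w | D i w = v].
  have := mp_measurable_dirs MP i measurableT (Y := [set v]).
  by rewrite setTI; apply.
have mX C' i : measurable C' -> measurable [set w | C' (X i w)].
  by move=> mC'; apply: sigma_points_measurable; exact: sigma_points_preimage.
rewrite (_ : marked C V = \bigcap_i (~` [set w | C (X i w)] `|`
   ([set w | V (X i w)] `&` [set w | D i w = true] `|`
    ~` [set w | V (X i w)] `&` [set w | D i w = false]))).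
  apply: bigcapT_measurable => i; apply: measurableU.
    by apply: measurableC; exact: mX.
  by apply: measurableU; apply: measurableI => //; [|apply: measurableC]; exact: mX.
apply/seteqP; split=> w /= H i.
  move=> _; have [Ci|?] := pselect (C (X i w)); last by left.
  right => /=; rewrite (H i Ci).
  by have [Vi|nVi] := pselect (V (X i w)); [left|right]; split=> //; apply/asboolP.
move=> Ci; have [//|[[Vi ->]|[nVi ->]]] := H i I; apply/esym; first exact/asboolP.
by apply/negP => /asboolP.
Qed.

(** On each of the finitely many values of [pattern], the points of [C] occupy a fixed set of [k]
    indices with fixed required directions, so [dirs_subset] applies. *)
Lemma thinning_bounded C V Z n k : measurable C -> measurable V ->
  sigma_points X Z ->
  P (bounded_by C n `&` (Z `&` counted C k) `&` marked C V) =
  (2^-1 ^+ k)%:E * P (bounded_by C n `&` (Z `&` counted C k)).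
Proof.
move=> mC mV sZ.
have sB := sigma_bounded n mC; have sK := sigma_counted k mC.
have sBZK : sigma_points X (bounded_by C n `&` (Z `&` counted C k)).
  by do 2! apply: (@measurableI _ GT) => //.
have mp s := sigma_pattern (n := n) s mC mV.
apply: (partition_scale (f := pattern C V n)).
- by move=> s; exact/sigma_points_measurable.
- by apply: measurableI; [exact/sigma_points_measurable|exact: measurable_marked].
- exact/sigma_points_measurable.
move=> s; have [sk|sk] := eqVneq (pcount s) k; last first.
  have e0 : bounded_by C n `&` (Z `&` counted C k) `&` pattern C V n @^-1` [set s] = set0.
    apply/seteqP; split=> // w [[bw [_ /(counted_pattern V k bw) ck]] /= ps].
    by move: sk; rewrite -ps ck eqxx.
  by rewrite setIAC e0 set0I measure0 mule0.
pose E := bounded_by C n `&` (Z `&` counted C k) `&` pattern C V n @^-1` [set s].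
have sE : sigma_points X E by apply: (@measurableI _ GT); [exact: sBZK|exact: mp].
have := dirs_subset (m := n) (n := n)
  (J := fun i => (nth (false, false) s i).1)
  (fun i => (nth (false, false) s i).2) sE (leqnn n).
rewrite -/(pcount s) sk setIAC -/E => <-; last first.
  by move=> i /andP[h1 h2]; move: (leq_ltn_trans h1 h2); rewrite ltnn.
congr (P _); apply/seteqP; split=> w [Ew H]; split=> //.
  move: Ew => [_ /patternP ps] i ni; rewrite (ps i ni) /= => /asboolP.
  exact: H.
move: Ew => [[bw _] /patternP ps] i Ci.
have ni : (i < n)%N by rewrite ltnNge; apply/negP => /bw.
by have := H i ni; rewrite (ps i ni) /=; apply; apply/asboolP.
Qed.

(** A monotone limit removes the bound on the indices, since finitely many points have bounded
    indices. *)
Lemma thinning C V Z k : measurable C -> measurable V -> sigma_points X Z ->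
  P (Z `&` counted C k `&` marked C V) =
  (2^-1 ^+ k)%:E * P (Z `&` counted C k).
Proof.
move=> mC mV sZ.
have lim E : measurable E -> E `<=` counted C k ->
    (fun n => P (bounded_by C n `&` E)) @ \oo --> P E.
  move=> mE EC; rewrite [X in _ --> P X](_ : E = \bigcup_n (bounded_by C n `&` E)).
    apply: nondecreasing_cvg_mu.
    - by move=> n; apply: measurableI => //; apply: sigma_points_measurable; exact: sigma_bounded.
    - by apply: bigcupT_measurable => n; apply: measurableI => //;
        apply: sigma_points_measurable; exact: sigma_bounded.
    - move=> n m nm; apply/subsetPset => w [bw Ew]; split=> // i mi.
      by apply: bw; exact: leq_trans mi.
  apply/seteqP; split=> [w Ew|w [n _ []]]//.
  have [n bn] : exists n, bounded_by C n w.
    by apply: finite_bounded; apply/finite_setP; exists k; exact: EC.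
  by exists n.
have mK := sigma_points_measurable (sigma_counted k mC).
have mZ := sigma_points_measurable sZ.
have mZK := measurableI _ _ mZ mK.
have mM := measurable_marked mC mV.
have sub1 : Z `&` counted C k `&` marked C V `<=` counted C k by move=> w [[]].
have sub2 : Z `&` counted C k `<=` counted C k by move=> w [].
have l1 := lim _ (measurableI _ _ mZK mM) sub1.
have e n : P (bounded_by C n `&` (Z `&` counted C k `&` marked C V)) =
    (2^-1 ^+ k)%:E * P (bounded_by C n `&` (Z `&` counted C k)).
  by rewrite [X in P X]setIA; exact: thinning_bounded.
rewrite (eq_fun e) in l1; apply: (cvg_unique _ l1) => //.
by apply: cvgeZl => //; exact: lim.
Qed.

Lemma probability_counted (C : set (R * R)) k : measurable C -> area C < +oo ->
  P (counted C k) = (poisson_weight (lambda * fine (area C)) k)%:E.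
Proof.
move=> mC C0; have := mp_counts MP (n := 1) (B := fun=> C) (fun=> k) (fun=> mC) (fun=> C0).
rewrite big_ord1 => <-; last by move=> i j _ _ _; rewrite !ord1.
by congr (P _); apply/seteqP; split=> w /= => [cw i|H]; [|exact: (H ord0)].
Qed.

Lemma probability_counted0 (C C' : set (R * R)) k : measurable C -> measurable C' ->
  area C < +oo -> area C' < +oo -> C `&` C' = set0 ->
  P (counted C' 0 `&` counted C k) =
  (poisson_weight (lambda * fine (area C)) k *
   poisson_weight (lambda * fine (area C')) 0)%:E.
Proof.
move=> mC mC' aC aC' CC'.
pose B (i : 'I_2) := if i == ord0 then C else C'.
pose K (i : 'I_2) := if i == ord0 then k else 0%N.
have := mp_counts MP (B := B) K.
rewrite big_ord_recl big_ord1 /B /K /= => <-.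
- congr (P _); apply/seteqP; split=> w /=.
    by move=> [h1 h2] i _ /=; case: (i == ord0).
  by move=> H; split; [exact: (H (lift ord0 ord0) I)|exact: (H ord0 I)].
- by move=> i; case: ifP.
- by move=> i; case: ifP.
- move=> i j _ _ [p []]; case: (eqVneq i ord0) => [->|i0]; case: (eqVneq j ord0) => [->//|j0] h1 h2.
  + by have : (C `&` C') p by []; rewrite CC'.
  + by have : (C `&` C') p by []; rewrite CC'.
  + by move: i j i0 j0 {h1 h2} => [[|[|i]] hi] [[|[|j]] hj] //= _ _; exact: val_inj.
Qed.

(** The generating function of the Poisson law: [x = 1] yields almost sure finiteness, [x = 1 / 2]
    the effect of thinning. *)
Lemma sum_poisson_weight (m x : R) : (0 <= m)%R -> (0 <= x)%R ->
  \sum_(k <oo) (x ^+ k * poisson_weight m k)%:E = (expR (x * m - m))%:E.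
Proof.
move=> m0 x0; rewrite expRD mulrC EFinM -(sum_exp_coeff (x * m)) -nneseriesZl; last first.
  by move=> k _; rewrite lee_fin divr_ge0// exprn_ge0// mulr_ge0.
apply: eq_eseriesr => k _; rewrite -EFinM /poisson_weight exprMn; congr EFin; ring.
Qed.

Lemma trivIset_counted C (A : nat -> set Omega) :
  (forall k, A k `<=` counted C k) -> trivIset setT A.
Proof.
move=> AC i j _ _ [w [/AC ci /AC cj]]; apply/card_eq_II.
by move: ci cj; rewrite /counted /= card_eq_sym => /card_eq_trans; apply.
Qed.

Hypothesis lambda_gt0 : (0 < lambda)%R.

Lemma area_ge0 (A : set (R * R)) : 0 <= area A.
Proof. exact: measure_ge0. Qed.

Lemma finite_almost_surely C : measurable C -> area C < +oo ->
  measurable (\bigcup_k counted C k) /\ P (\bigcup_k counted C k) = 1.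
Proof.
move=> mC aC; have mK k := sigma_points_measurable (sigma_counted k mC).
have mU : measurable (\bigcup_k counted C k) by exact: bigcupT_measurable.
split=> //; rewrite (measure_semi_bigcup P)//; last by apply: (@trivIset_counted C) => k w.
have m0 : (0 <= lambda * fine (area C))%R by rewrite mulr_ge0 ?(ltW lambda_gt0)// fine_ge0// area_ge0.
have := sum_poisson_weight m0 ler01; rewrite mul1r subrr expR0 => <-.
by apply: eq_eseriesr => k _; rewrite expr1n mul1r; exact: probability_counted.
Qed.

Definition slice (V : set (@seed R)) (b : bool) : set (R * R) := [set p | V (p, b)].

(** For slices of finite area, [lambda / 2 * weight V] is the mean number of marked points in
    [V]. *)
Definition weight (V : set (@seed R)) : R :=
  (fine (area (slice V false)) + fine (area (slice V true)))%R.

Lemma measurable_slice V b : measurable V -> measurable (slice V b).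
Proof.
move=> mV; have : measurable_fun setT (fun p : R * R => (p, b)).
  exact: measurable_fun_pair.
by move=> /(_ measurableT _ mV); rewrite setTI.
Qed.

Definition points (w : Omega) : set (@seed R) := [set (X i w, D i w) | i in setT].

Lemma measurable_void_points V : measurable V -> measurable (void points V).
Proof.
move=> mV; rewrite (_ : void points V =
    \bigcap_i ~` ((fun w => (X i w, D i w)) @^-1` V)).
  apply: bigcapT_measurable => i; apply: measurableC; rewrite -[_ @^-1` _]setTI.
  have mf : measurable_fun setT (fun w => (X i w, D i w)).
    by apply: measurable_fun_pair; [exact: (mp_measurable_points MP)|exact: (mp_measurable_dirs MP)].
  exact: mf.
apply/seteqP; split=> w /= H; first by move=> i _; apply: H; exists i.
by move=> _ [i _ <-]; exact: H.
Qed.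

Lemma area_lty_sub (A B : set (R * R)) : measurable A -> measurable B -> A `<=` B ->
  area B < +oo -> area A < +oo.
Proof. by move=> mA mB AB; apply: le_lt_trans; apply: le_measure; rewrite ?inE. Qed.

Lemma fine_areaDI (A B : set (R * R)) : measurable A -> measurable B -> area A < +oo ->
  fine (area A) = (fine (area (A `\` B)) + fine (area (A `&` B)))%R.
Proof.
move=> mA mB aA; have mAB := measurableD mA mB; have mAB' := measurableI _ _ mA mB.
have e : area A = area (A `\` B) + area (A `&` B) by exact: measureDI.
rewrite e fineD//.
  by rewrite ge0_fin_numE ?area_ge0//; apply: area_lty_sub aA.
by rewrite ge0_fin_numE ?area_ge0//; apply: area_lty_sub aA.
Qed.

(* Each point falling where [V] forbids exactly one direction avoids [V] with
   probability 1/2, and no point may fall where [V] forbids both. *)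
Lemma probability_void V : measurable V ->
  (forall b, area (slice V b) < +oo) ->
  P (void points V) = (expR (- (lambda / 2 * weight V)))%:E.
Proof.
move=> mV aV; have mS b := measurable_slice b mV.
pose F := slice V false; pose T := slice V true.
have mF : measurable F by exact: mS.
have mT : measurable T by exact: mS.
pose C := (F `\` T) `|` (T `\` F); pose C' := F `&` T.
have mC : measurable C by apply: measurableU; exact: measurableD.
have mC' : measurable C' by exact: measurableI.
have aC' : area C' < +oo by apply: area_lty_sub (aV false) => // p [].
have mFT : measurable (F `\` T) by exact: measurableD.
have mTF : measurable (T `\` F) by exact: measurableD.
have aFT : area (F `\` T) < +oo by apply: area_lty_sub (aV false) => // p [].
have aTF : area (T `\` F) < +oo by apply: area_lty_sub (aV true) => // p [].
have eC : area C = area (F `\` T) + area (T `\` F).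
  by apply: measureU => //; apply/seteqP; split=> // p [[_ ?] [? _]].
have aC : area C < +oo by rewrite eC lte_add_pinfty.
have CC' : C `&` C' = set0 by apply/seteqP; split=> // p [[[_ ?]|[_ ?]] [? ?]].
(* Places with both directions forbidden count twice: they contribute [lambda] per unit of area to
   the exponent, the others [lambda / 2]. *)
have wE : weight V = (fine (area C) + 2 * fine (area C'))%R.
  have := fine_areaDI mF mT (aV false); have := fine_areaDI mT mF (aV true).
  have : fine (area C) = (fine (area (F `\` T)) + fine (area (T `\` F)))%R.
    by rewrite eC fineD ?ge0_fin_numE ?area_ge0.
  by rewrite (setIC T) /weight -/F -/T -/C' => -> -> ->; ring.
have voidE : void points V = counted C' 0 `&` marked C F.
  apply/seteqP; split=> w /=.
    move=> H; have H' i b : ~ slice V b (X i w) \/ D i w <> b.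
      have [h|] := pselect (D i w = b); last by right.
      by left => h'; apply: (H (X i w, D i w)); [exists i|rewrite h].
    split.
      rewrite /counted /= II0 card_eq0; apply/eqP/seteqP; split=> // i [h1 h2].
      by have [|] := H' i (D i w); [case: (D i w)|].
    move=> i Ci; case: asboolP => [f|nf].
      by have [//|] := H' i false; case: (D i w).
    case: Ci => -[h1 h2]; first by [].
    by have [//|] := H' i true; case: (D i w).
  move=> [c0 H] _ [i _ <-] /= VX.
  have nC' : ~ C' (X i w).
    move: c0; rewrite /counted /= II0 card_eq0 => /eqP e h.
    by have : indices C' w i by []; rewrite e.
  have Ci : C (X i w).
    case E: (D i w) VX => VX; [right|left]; split=> // h; exact: nC'.
  move: (H i Ci) VX nC'; case: asboolP => h -> VX; first by apply.
  by [].
have [mU PU] := finite_almost_surely mC aC.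
have mK k := sigma_points_measurable (sigma_counted k mC).
have mK' k := sigma_points_measurable (sigma_counted k mC').
have mM : measurable (marked C F) by apply: measurable_marked.
have mCM : measurable (counted C' 0 `&` marked C F) by exact: measurableI.
transitivity (P (\bigcup_k (counted C' 0 `&` counted C k `&` marked C F))).
  apply: (probability_eq_full mU PU); first exact: measurable_void_points.
    by apply: bigcupT_measurable => k; do 2! apply: measurableI => //.
  rewrite voidE; apply/seteqP; split=> w.
    by move=> [[? ?] [k _ ?]]; split; exists k.
  by move=> [[k _ [[? ?] ?]] [? ? ?]]; split=> //; exists k.
rewrite (measure_semi_bigcup P); first last.
- by apply: bigcupT_measurable => k; do 2! apply: measurableI => //.
- by apply: (@trivIset_counted C) => k w [[]].
- by move=> k; do 2! apply: measurableI => //.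
have m0 : (0 <= lambda * fine (area C))%R by rewrite mulr_ge0 ?(ltW lambda_gt0)// fine_ge0// area_ge0.
have h0 : (0 <= 2^-1 :> R)%R by [].
transitivity ((expR (- (lambda * fine (area C'))))%:E *
    \sum_(k <oo) (2^-1 ^+ k * poisson_weight (lambda * fine (area C)) k)%:E).
  rewrite -nneseriesZl; last first.
    move=> k _; rewrite lee_fin mulr_ge0 ?exprn_ge0// /poisson_weight.
    by rewrite divr_ge0// mulr_ge0 ?expR_ge0 ?exprn_ge0.
  apply: eq_eseriesr => k _; rewrite -EFinM.
  apply: etrans (thinning k mC (mS false) (sigma_counted 0 mC')) _.
  rewrite probability_counted0// -!EFinM; congr EFin.
  rewrite {2}/poisson_weight expr0 fact0 divr1 mulr1; ring.
rewrite sum_poisson_weight// -EFinM -expRD wE; congr (expR _)%:E.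
by field.
Qed.


End Thinning.

(** * Areas of boxes and cells *)

Section Areas.
Context {R : realType}.
Implicit Types p : R * R.

Lemma area_rectangle (a b c e : R) (x y : bool) : a < b -> c < e ->
  area ([set` Interval (BSide x a) (BRight b)] `*`
        [set` Interval (BSide y c) (BRight e)]) = ((b - a) * (e - c))%:E.
Proof.
move=> ab ce; rewrite /area product_measure1E; [|exact: measurable_itv|exact: measurable_itv].
have L (u v : R) w : u < v ->
    lebesgue_measure [set` Interval (BSide w u) (BRight v)] = (v - u)%:E.
  by move=> uv; rewrite lebesgue_measure_itv /= lte_fin uv -EFinB.
by rewrite EFinM; congr (_ * _)%E; exact: L.
Qed.

Lemma box_rectangle p (a : R) :
  box p a = `[p.1 - a, p.1 + a] `*` `[p.2 - a, p.2 + a].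
Proof.
apply/seteqP; split=> q /=; rewrite /box /= !in_itv /= !ler_norml.
  by move=> [/andP[? ?] /andP[? ?]]; split; apply/andP; split; lra.
by move=> [/andP[? ?] /andP[? ?]]; split; apply/andP; split; lra.
Qed.

Lemma measurable_box p (a : R) : measurable (box p a).
Proof. by rewrite box_rectangle; apply: measurableX; exact: measurable_itv. Qed.

Lemma area_box p (a : R) : 0 < a -> area (box p a) = (4 * a ^+ 2)%:E.
Proof.
by move=> a0; rewrite box_rectangle area_rectangle; [congr EFin; ring|lra|lra].
Qed.

Lemma area_box_lty p (a : R) : (area (box p a) < +oo)%E.
Proof.
have b0 : 0 < `|a| + 1 by rewrite ltr_wpDl.
apply: (@area_lty_sub _ _ (box p (`|a| + 1))); [exact: measurable_box..| |].
  move=> q [h1 h2]; split; [apply: le_trans h1 _|apply: le_trans h2 _];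
  by rewrite (le_trans (ler_norm a))// lerDl.
by rewrite area_box// ltry.
Qed.

Lemma slice_cell r (z e : R) b : slice (cell r z e) b =
  if b == (source r).2 then set0 else
  if b then `[(tip r z).1 - e, (tip r z).1 + e] `*` `](tip r z).2, (tip r z).2 + e]
  else `](tip r z).1, (tip r z).1 + e] `*` `[(tip r z).2 - e, (tip r z).2 + e].
Proof.
rewrite /slice /cell; case: (tip r z) => x y.
apply/seteqP; split=> -[p q] /=; rewrite /along;
  case: (source r).2; case: b => //=; rewrite ?in_itv /= ?in_itv /= ?ler_norml.
all: try by case.
all: try by move=> [_ /andP[? ?] /andP[? ?]]; split; apply/andP; split; lra.
all: by move=> [/andP[? ?] /andP[? ?]]; split=> //; apply/andP; split; lra.
Qed.

Lemma measurable_slices (V : set (@seed R)) :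
  (forall b, measurable (slice V b)) -> measurable V.
Proof.
move=> mV; rewrite (_ : V = (slice V true `*` [set true]) `|` (slice V false `*` [set false])).
  by apply: measurableU; apply: measurableX.
apply/seteqP; split=> -[p b] /=; first by case: b; [left|right].
by case=> -[/= + ->].
Qed.

Lemma measurable_cell r (z e : R) : measurable (cell r z e).
Proof.
apply: measurable_slices => b; rewrite slice_cell; case: ifP => _; first exact: measurable0.
by case: b; apply: measurableX; exact: measurable_itv.
Qed.

Lemma weight_cell r (z e : R) : 0 < e -> weight (cell r z e) = 2 * e ^+ 2.
Proof.
move=> e0; have a0 : area set0 = 0%E :> \bar R by exact: measure0.
rewrite /weight !slice_cell; case: (source r).2 => /=; rewrite a0 area_rectangle ?ltrDl//; try lra.
all: rewrite /=; ring.
Qed.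

Definition boxed p (a : R) : set (@seed R) := [set x | box p a x.1].

Lemma measurable_boxed p a : measurable (boxed p a).
Proof. by apply: measurable_slices => b; exact: measurable_box. Qed.

Lemma weight_boxed p (a : R) : 0 < a -> weight (boxed p a) = 8 * a ^+ 2.
Proof.
by move=> a0; rewrite /weight /slice /boxed /= !(area_box _ a0) /=; ring.
Qed.

Lemma area_slice_lty (V : set (@seed R)) p a b : measurable V ->
  V `<=` boxed p a -> (area (slice V b) < +oo)%E.
Proof.
move=> mV Vb; apply: area_lty_sub (area_box_lty p a).
- exact: measurable_slice.
- exact: measurable_box.
- by move=> q /Vb.
Qed.

Lemma weightU (V W : set (@seed R)) p a : measurable V -> measurable W ->
  V `<=` boxed p a -> W `<=` boxed p a -> V `&` W = set0 ->
  weight (V `|` W) = weight V + weight W.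
Proof.
move=> mV mW Vb Wb VW.
have H b : fine (area (slice (V `|` W) b)) = fine (area (slice V b)) + fine (area (slice W b)).
  have -> : slice (V `|` W) b = slice V b `|` slice W b by [].
  have -> : area (slice V b `|` slice W b) = (area (slice V b) + area (slice W b))%E.
    apply: measureU; [exact: measurable_slice|exact: measurable_slice|].
    by apply/seteqP; split=> // q [h1 h2]; have : (V `&` W) (q, b) by []; rewrite VW.
  by rewrite fineD// ge0_fin_numE ?area_ge0//; [exact: area_slice_lty Vb|exact: area_slice_lty Wb].
exact: etrans (congr2 +%R (H false) (H true)) (addrACA _ _ _ _).
Qed.

End Areas.

(** * Locally finite configurations *)

Section Regular.
Context {R : realType} {lambda : R} {d : measure_display} {Omega : measurableType d}.
Context {P : probability Omega R} {X : nat -> Omega -> R * R} {D : nat -> Omega -> bool}.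
Hypotheses (MP : marked_poisson lambda P X D) (lambda_gt0 : 0 < lambda).
Local Open Scope ereal_scope.

Definition good : set Omega :=
  \bigcap_M \bigcup_k counted (X := X) (box (0, 0)%R M%:R) k.

Let finite_box (M : nat) :=
  finite_almost_surely MP lambda_gt0 (measurable_box (0, 0)%R M%:R) (area_box_lty _ _).

Lemma measurable_good : measurable good.
Proof. by apply: bigcapT_measurable => M; case: (finite_box M). Qed.

Lemma probability_good : P good = 1.
Proof.
have mg := measurable_good.
have e : P (~` ~` good) = 1 - P (~` good) by apply: probability_setC; exact: measurableC.
suff z : P (~` good) = 0 by move: e; rewrite setCK z sube0.
apply/eqP; rewrite eq_le measure_ge0 andbT.
pose F M := ~` \bigcup_k counted (X := X) (box (0, 0)%R M%:R) k.
have F0 M : P (F M) = 0.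
  by have [mU PU] := finite_box M; rewrite /F probability_setC// PU subee.
have : P (~` good) <= \sum_(M <oo) P (F M).
  apply: measure_sigma_subadditive.
  - by move=> M; apply: measurableC; case: (finite_box M).
  - exact: measurableC.
  - by rewrite /good setC_bigcap.
by rewrite eseries0.
Qed.

(* The Poisson points, with the exceptional event where they accumulate removed. *)
Definition regular (w : Omega) : set (@seed R) :=
  [set x | good w /\ points (X := X) (D := D) w x].

Lemma good_locfin w : good w -> locfin (points (X := X) (D := D) w).
Proof.
move=> gw p a; pose M := Num.bound (`|p.1| + `|p.2| + `|a|).
have finI : finite_set (indices (X := X) (box (0, 0)%R M%:R) w).
  by apply/finite_setP; have [k' _ ck] := gw M I; exists k'.
apply: sub_finite_set (finite_image (fun i => (X i w, D i w)) finI).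
move=> _ [[i _ <-] /= [b1 b2]]; exists i => //.
have : (`|p.1| + `|p.2| + `|a| < M%:R)%R by exact: archi_boundP.
have := ler_norm a; have := normr_ge0 p.1; have := normr_ge0 p.2.
have := ler_normD ((X i w).1 - p.1)%R p.1; have := ler_normD ((X i w).2 - p.2)%R p.2.
by rewrite !subrK /indices /box /= !subr0 => *; split; lra.
Qed.

Lemma locfin_regular w : locfin (regular w).
Proof.
move=> p a; have [gw|ngw] := pselect (good w).
  by apply: sub_finite_set (good_locfin gw p a) => x [[_ ?] ?].
by rewrite (_ : [set x | _] = set0)//; apply/seteqP; split=> // x [[]].
Qed.

Lemma measurable_void_regular V : measurable V -> measurable (void regular V).
Proof.
move=> mV; rewrite (_ : void regular V = ~` good `|` void (points (X := X) (D := D)) V).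
  apply: measurableU; first by apply: measurableC; exact: measurable_good.
  exact: (measurable_void_points MP).
apply/seteqP; split=> w /= H.
  by have [gw|ngw] := pselect (good w); [right=> x px; apply: H|left].
by case: H => H x [gw px]; [|exact: H].
Qed.

Lemma probability_void_regular V p a : measurable V -> V `<=` boxed p a ->
  P (void regular V) = (expR (- (lambda / 2 * weight V)))%:E.
Proof.
move=> mV Vb; rewrite -(probability_void MP lambda_gt0 mV); last first.
  by move=> b; exact: area_slice_lty Vb.
apply: (probability_eq_full measurable_good probability_good).
- exact: measurable_void_regular.
- exact: (measurable_void_points MP).
apply/seteqP; split=> w [H gw]; split=> // x; first by move=> px; apply: H.
by move=> [_ px]; exact: H.
Qed.

Lemma voidU (S : Omega -> set (@seed R)) V W :
  void S V `&` void S W = void S (V `|` W).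
Proof.
apply/seteqP; split=> w; first by move=> [H1 H2] x Sx [/(H1 _ Sx)|/(H2 _ Sx)].
by move=> H; split=> x Sx ?; apply: (H x Sx); [left|right].
Qed.

Lemma independent_regular (B B' : set (@seed R)) p a : B `<=` boxed p a ->
  B' `<=` boxed p a -> B `&` B' = set0 -> forall E F,
  <<s voids regular B >> E -> <<s voids regular B' >> F -> P (E `&` F) = P E * P F.
Proof.
move=> Bb B'b BB'; apply: independent_voids; first exact: measurable_void_regular.
move=> V W mV mW VB WB'; rewrite voidU.
have Vb := subset_trans VB Bb; have Wb := subset_trans WB' B'b.
have mVW := measurableU _ _ mV mW.
have VWb : V `|` W `<=` boxed p a by move=> x [/Vb|/Wb].
have VW : V `&` W = set0.
  by apply/seteqP; split=> // x [/VB ? /WB' ?]; rewrite -BB'.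
rewrite (probability_void_regular mVW VWb) (probability_void_regular mV Vb).
rewrite (probability_void_regular mW Wb) (weightU mV mW Vb Wb VW).
by rewrite -EFinM -expRD mulrDr opprD.
Qed.

Lemma locfin_config a b w : good w -> locfin (config X D a b w).
Proof.
move=> gw p c; apply: (@sub_finite_set _ _
  ([set x | points (X := X) (D := D) w x /\ box p c x.1] `|` [set a; b])).
  by move=> x [[px|ab] bx]; [left|right].
by rewrite finite_setU; split; [exact: good_locfin|exact: finite_set2].
Qed.

Lemma A_live a b r t w : good w -> source r = a ->
  A (config X D a b) r t w <-> live (config X D a b w) r t.
Proof.
move=> gw ra; have Sr : config X D a b w (source r) by right; left.
rewrite -(gilbert_live t (locfin_config a b gw) Sr) /A /len /=.
by split=> [/eqP|/min_idPl//]; rewrite eq_minl.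
Qed.

(** The seed [b] is outside the light cone, hence invisible to [r]; what remains depends only on the
    Poisson points in the box. *)
Lemma A_localized a b r t : source r = a -> ~ box (tip r t) t b.1 ->
  A (config X D a b) r t `&` good =
  [set w | live (observed regular (boxed (tip r t) t) a w) r t] `&` good.
Proof.
move=> ra nb; apply/seteqP.
suff H w : good w -> A (config X D a b) r t w <->
    live (observed regular (boxed (tip r t) t) a w) r t.
  by split=> w [Aw gw]; split=> //; apply/H.
move=> gw; rewrite A_live//; apply: live_local => x bx; split.
  move=> [px|[->|xb]]; [by left|by right|].
  by move: bx nb; rewrite xb.
by move=> [[[_ px] _]|->]; [left|right; left].
Qed.

End Regular.

(** * Survival probability *)

Section Tail.
Context {R : realType} {lambda : R} {d : measure_display} {Omega : measurableType d}.
Context {P : probability Omega R} {X : nat -> Omega -> R * R} {D : nat -> Omega -> bool}.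
Hypotheses (MP : marked_poisson lambda P X D) (lambda_gt0 : 0 < lambda).
Variables (r : @ray R) (e : R).
Hypotheses (e_gt0 : 0 < e) (le2 : lambda * e ^+ 2 = 1).

Let S := regular (X := X) (D := D).

(** Boxes of radius [3 * e] spaced by [8 * e] are disjoint, and starting at [8 * e] keeps the source
    of [r] out of them. *)
Let z (k : nat) : R := k.+1%:R * (8 * e).

Let free (k : nat) := boxed (tip r (z k)) (3 * e) `\` cell r (z k) e.

Let blocker (k : nat) : set Omega := void S (free k) `&` ~` void S (cell r (z k) e).

(* With [lambda * e ^+ 2 = 1], the Poisson points avoid [free k] with probability
   [expR (- 35)] and the whole box with probability [expR (- 36)]. *)
Definition block_prob : R := expR (- 35) - expR (- 36).

Let measurable_free k : measurable (free k).
Proof. by apply: measurableD; [exact: measurable_boxed|exact: measurable_cell]. Qed.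

Let mvoid V : measurable V -> measurable (void S V).
Proof. exact: (measurable_void_regular MP lambda_gt0). Qed.

Let measurable_blocker k : measurable (blocker k).
Proof.
apply: measurableI; first exact: mvoid.
by apply: measurableC; apply: mvoid; exact: measurable_cell.
Qed.

Let probability_not_blocker k : P (~` blocker k) = (1 - block_prob)%:E.
Proof.
have mc := measurable_cell r (z k) e; have mf := measurable_free k.
have cb : cell r (z k) e `<=` boxed (tip r (z k)) (3 * e) by exact: cell_box.
have fb : free k `<=` boxed (tip r (z k)) (3 * e) by move=> x [].
have UE : free k `|` cell r (z k) e = boxed (tip r (z k)) (3 * e).
  by rewrite /free setUC setDUK.
have IE : free k `&` cell r (z k) e = set0 by rewrite /free setIC setDIK.
(* The box has weight [8 * 9 * e ^+ 2] and the cell [2 * e ^+ 2]. *)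
have wf : weight (free k) = 70 * e ^+ 2.
  have := weightU mf mc fb cb IE; rewrite UE weight_boxed ?mulr_gt0// weight_cell//.
  by move=> h; apply: (addIr (2 * e ^+ 2)); rewrite -h; ring.
have l2 (c : R) : lambda / 2 * (2 * c * e ^+ 2) = c.
  by rewrite -[RHS]mulr1 -[X in _ = _ * X]le2; field.
have p1 : P (void S (free k)) = (expR (- 35))%:E.
  rewrite (probability_void_regular MP lambda_gt0 mf fb) wf.
  by congr (expR (- _))%:E; rewrite -[RHS]l2; ring.
have p2 : P (void S (free k) `&` void S (cell r (z k) e)) = (expR (- 36))%:E.
  rewrite voidU UE.
  rewrite (probability_void_regular MP lambda_gt0 (@measurable_boxed _ _ _) (fun x h => h)).
  rewrite weight_boxed ?mulr_gt0//.
  by congr (expR (- _))%:E; rewrite -[RHS]l2; ring.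
have h : P (void S (free k)) = (P (blocker k) +
    P (void S (free k) `&` void S (cell r (z k) e)))%E.
  exact: (measureDI P (mvoid mf) (mvoid mc)).
have fin : P (blocker k) \is a fin_num by apply: fin_num_measure; exact: measurable_blocker.
have pb : P (blocker k) = block_prob%:E.
  move: h; rewrite p1 p2 -(fineK fin) -EFinD => -[h].
  by rewrite /block_prob h; congr EFin; ring.
rewrite probability_setC//; first by rewrite pb -EFinB.
Qed.

Let region (n : nat) : set (@seed R) :=
  \bigcup_(k in `I_n) boxed (tip r (z k)) (3 * e).

Let unblocked (n : nat) : set Omega := \bigcap_(k in `I_n) ~` blocker k.

Let blocker_local (B : set (@seed R)) k : boxed (tip r (z k)) (3 * e) `<=` B ->
  <<s voids S B >> (~` blocker k).
Proof.
move=> kB; pose G := g_sigma_algebraType (voids S B).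
have mv V : measurable V -> V `<=` boxed (tip r (z k)) (3 * e) ->
    (@measurable _ G) (void S V).
  by move=> mV Vk; apply: sub_sigma_algebra; exists V => //; split=> // x /Vk /kB.
apply: (@measurableC _ G); apply: (@measurableI _ G).
  by apply: mv => // x [].
by apply: (@measurableC _ G); apply: mv; [exact: measurable_cell|exact: cell_box].
Qed.

Let unblocked_local n : <<s voids S (region n) >> (unblocked n).
Proof.
apply: (@fin_bigcap_measurable _ (g_sigma_algebraType (voids S (region n)))).
  exact: finite_II.
by move=> k /= kn; apply: blocker_local => x bx; exists k.
Qed.

Let tip_along k : along (source r).2 (tip r (z k)) =
  along (source r).2 (source r).1 + sgn (sign r) * z k.
Proof. by rewrite /along /tip; case: (source r).2 => /=; rewrite mulr1. Qed.

Let boxed_along k x : boxed (tip r (z k)) (3 * e) x ->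
  `|along (source r).2 x.1 - along (source r).2 (tip r (z k))| <= 3 * e.
Proof. by rewrite /boxed /box /along /=; case: (source r).2 => -[]. Qed.

Lemma probability_unblocked n : P (unblocked n) = ((1 - block_prob) ^+ n)%:E.
Proof.
elim: n => [|n IH].
  by rewrite /unblocked II0 bigcap_set0 probability_setT.
have -> : unblocked n.+1 = unblocked n `&` ~` blocker n.
  apply/seteqP; split=> w /=.
    by move=> H; split=> [k /= kn|]; apply: H => /=; rewrite // ltnS ltnW.
  by move=> [H Hn] k /=; rewrite ltnS leq_eqVlt => /predU1P[->//|]; exact: H.
have zlt (i j : nat) : (i < j)%N -> z i + 8 * e <= z j.
  move=> ij; rewrite /z -{2}[8 * e]mul1r -mulrDl ler_pM2r ?mulr_gt0//.
  by rewrite -[X in _ + X]/(1%:R) -natrD ler_nat addn1.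
have z_ge0 k : 0 <= z k by rewrite mulr_ge0// mulr_ge0// ltW.
have sub k : (k <= n)%N -> boxed (tip r (z k)) (3 * e) `<=`
    boxed (source r).1 (z n + 3 * e).
  move=> kn; suff h : box (source r).1 (z n) (tip r (z k)) by move=> x /(box_sub h).
  have zk : z k <= z n.
    by rewrite ler_wpM2r ?mulr_ge0 ?(ltW e_gt0)// ler_nat.
  have := z_ge0 k; rewrite /box /tip /=.
  by case: (source r) => [[x y] []]; case: (sign r) => /= ?; split;
    apply/ler_normlP; split; lra.
rewrite (independent_regular MP lambda_gt0 (B := region n)
  (B' := boxed (tip r (z n)) (3 * e)) (p := (source r).1) (a := z n + 3 * e)).
- by rewrite IH probability_not_blocker -EFinM exprSr.
- by move=> x [k /= kn]; apply: sub; exact: ltnW.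
- exact: sub.
- apply/seteqP; split=> // x [[k /= kn /boxed_along h1] /boxed_along h2].
  have := zlt _ _ kn; move: h1 h2; rewrite !tip_along.
  rewrite /sgn; move: (z k) (z n) (along _ x.1) (along _ (source r).1) => a b c1 c2.
  have e0 := e_gt0; clear IH.
  by case: (sign r); rewrite ?mul1r ?mulN1r => /ler_normlP[? ?] /ler_normlP[? ?] ?; lra.
- exact: unblocked_local.
- exact: blocker_local.
Qed.

Lemma A_unblocked b t n w : n%:R * (10 * e) < t ->
  (forall k, (k < n)%N -> ~ boxed (tip r (z k)) (3 * e) b) ->
  good (X := X) w -> A (config X D (source r) b) r t w -> unblocked n w.
Proof.
move=> nt nb gw /(A_live (D := D) b t gw erefl) al k /= kn [vf nvc].
have e0 := e_gt0.
have k1 : 1 <= k.+1%:R :> R by rewrite ler1n.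
have kn' : k.+1%:R <= n%:R :> R by rewrite ler_nat.
have zk : 8 * e <= z k by rewrite /z -[leLHS]mul1r ler_pM2r ?mulr_gt0.
have zkt : z k + e < t.
  have h1 : z k <= n%:R * (8 * e) by rewrite /z ler_pM2r ?mulr_gt0.
  have h2 : e <= n%:R * e by rewrite -[leLHS]mul1r ler_pM2r// (le_trans k1).
  by lra.
have Sr : config X D (source r) b w (source r) by right; left.
have e2 : 2 * e <= z k by lra.
apply: (blocked (locfin_config (source r) b gw) Sr e2 zkt _ _ al).
  (* A Poisson point of the box is in the cell because [free k] is empty; the source of [r] is at
     least [8 * e] behind, and [b] is excluded by [nb]. *)
  move=> x [px bx|[->|->]].
  - apply: contrapT => nc; apply: (vf x) => //.
  - move=> /boxed_along; rewrite tip_along opprD addrA subrr sub0r normrN.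
    by case: (sign r) => /= /ler_normlP[? ?]; lra.
  - by move=> /nb; case.
move: nvc => /existsNP[x /not_implyP[[_ px] /contrapT cx]].
by exists x => //; left.
Qed.

Lemma outer_tail b t n : n%:R * (10 * e) < t ->
  (forall k, (k < n)%N -> ~ boxed (tip r (z k)) (3 * e) b) ->
  ((P^*)%mu (A (config X D (source r) b) r t) <= ((1 - block_prob) ^+ n)%:E)%E.
Proof.
move=> nt nb; rewrite -probability_unblocked.
have mu : measurable (unblocked n).
  apply: fin_bigcap_measurable; first exact: finite_II.
  by move=> k _; apply: measurableC; exact: measurable_blocker.
rewrite -(outer_eq_full (measurable_good MP lambda_gt0) (probability_good MP lambda_gt0)
  (E := unblocked n `|` ~` good (X := X)) mu); last first.
  by rewrite setIUl setICl setU0.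
apply: le_mu_ext => w Aw; have [gw|] := pselect (good (X := X) w); last by right.
by left; exact: A_unblocked Aw.
Qed.

End Tail.

(** * Covariance *)

Lemma dist1_tip {R : realType} (r : @ray R) (s a : R) q : 0 <= s ->
  box (tip r s) a q -> dist1 (source r).1 q <= 2 * (s + a).
Proof.
rewrite /box /tip /dist1; case: (source r) => [[x y] []]; case: (sign r);
  case: q => q1 q2 /= s0 [/ler_normlP[? ?] /ler_normlP[? ?]];
  case: (ger0P (x - q1)) => ?; case: (ger0P (y - q2)) => ?; lra.
Qed.

Lemma boxed_tip {R : realType} (r : @ray R) (s : R) : 0 <= s ->
  boxed (tip r s) s `<=` boxed (source r).1 (s + s).
Proof.
move=> s0 x; apply: box_sub; move: s0; rewrite /box /tip.
by case: (source r) => [[a b] []]; case: (sign r) => /= ?; split;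
  apply/ler_normlP; split; lra.
Qed.

Lemma dist1_triangle {R : realType} (u v w : R * R) :
  dist1 u w <= dist1 u v + dist1 v w.
Proof.
rewrite /dist1 addrACA; apply: lerD.
  by rewrite -[X in `|X|](subrKA v.1) ler_normD.
by rewrite -[X in `|X|](subrKA v.2) ler_normD.
Qed.

Lemma dist1C {R : realType} (u v : R * R) : dist1 u v = dist1 v u.
Proof. by rewrite /dist1 distrC (distrC u.2). Qed.

Lemma dist1_gt0 {R : realType} (u v : R * R) : u <> v -> 0 < dist1 u v.
Proof.
move=> uv; rewrite /dist1 lt_neqAle addr_ge0// andbT eq_sym paddr_eq0//.
rewrite !normr_eq0 !subr_eq0; apply/negP => /andP[/eqP e1 /eqP e2].
by apply: uv; rewrite (surjective_pairing u) e1 e2; case: (v).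
Qed.

Lemma configC {R : realType} {d : measure_display} {Omega : measurableType d}
    (X : nat -> Omega -> R * R) (D : nat -> Omega -> bool) a b :
  config X D a b = config X D b a.
Proof. by apply/funext => w; rewrite /config setUC [[set a; b]]setUC setUC. Qed.

Section Covariance.
Context {R : realType} {lambda : R} {d : measure_display} {Omega : measurableType d}.
Context {P : probability Omega R} {X : nat -> Omega -> R * R} {D : nat -> Omega -> bool}.
Hypotheses (MP : marked_poisson lambda P X D) (lambda_gt0 : 0 < lambda).

(** Both terms of the covariance lie between 0 and the outer measure of [E]. *)
Lemma Cov_le (E F : set Omega) (q : R) : ((P^*)%mu E <= q%:E)%E -> `|Cov P E F| <= q.
Proof.
move=> Eq.
have le1 A : ((P^*)%mu A <= 1)%E.
  rewrite -(@probability_setT _ _ _ P) -(measurable_mu_extE P measurableT).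
  exact: le_mu_ext.
have ge0 A : (0 <= (P^*)%mu A)%E by exact: mu_ext_ge0.
have fn A : (P^*)%mu A \is a fin_num.
  by rewrite ge0_fin_numE//; apply: le_lt_trans (le1 A) _; rewrite ltry.
have fE : fine ((P^*)%mu E) <= q by rewrite -lee_fin fineK.
have f0 A : 0 <= fine ((P^*)%mu A) by exact: fine_ge0.
have f1 : fine ((P^*)%mu F) <= 1 by rewrite -lee_fin fineK.
have fEF : fine ((P^*)%mu (E `&` F)) <= fine ((P^*)%mu E).
  by rewrite fine_le//; apply: le_mu_ext => x [].
have := f0 E; have := f0 F; have := f0 (E `&` F); move: fE f1 fEF.
rewrite /Cov; move: (fine _) (fine _) (fine _) => a b c *.
by apply/ler_normlP; split; nra.
Qed.

Lemma Cov_independent (E F E' F' : set Omega) : measurable E' -> measurable F' ->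
  P (E' `&` F') = (P E' * P F')%E ->
  E `&` good (X := X) = E' `&` good (X := X) ->
  F `&` good (X := X) = F' `&` good (X := X) -> Cov P E F = 0.
Proof.
move=> mE mF EF eE eF.
have mg := measurable_good MP lambda_gt0; have Pg := probability_good MP lambda_gt0.
rewrite /Cov (outer_eq_full mg Pg mE eE) (outer_eq_full mg Pg mF eF).
rewrite (outer_eq_full mg Pg (measurableI _ _ mE mF)); last first.
  by rewrite setIIl eE eF -setIIl.
by rewrite EF fineM ?subrr// fin_num_measure.
Qed.

(** By [dist1_tip], each light cone stays within l1 distance [4 * t] of its source, whence the
    factor 8. *)
Lemma Cov_near (u v : R * R) (du dv sigma tau : bool) (t : R)
    (S := config X D (u, du) (v, dv)) :
  0 < t -> 8 * t < dist1 u v ->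
  Cov P (A S (Ray (u, du) sigma) t) (A S (Ray (v, dv) tau) t) = 0.
Proof.
move=> t0 tuv; pose ru := Ray (u, du) sigma; pose rv := Ray (v, dv) tau.
have vfar : ~ box (tip ru t) t v by move=> /(dist1_tip (ltW t0)) /=; lra.
have ufar : ~ box (tip rv t) t u.
  by move=> /(dist1_tip (ltW t0)); rewrite dist1C /=; lra.
have loc r a : <<s voids (regular (X := X) (D := D)) (boxed (tip r t) t) >>
    [set w | live (observed (regular (X := X) (D := D)) (boxed (tip r t) t) a w) r t].
  by apply: measurable_live; [exact: locfin_regular|exact: measurable_boxed].
have meas r : <<s voids (regular (X := X) (D := D)) (boxed (tip r t) t) >> `<=` measurable.
  apply: smallest_sub; first exact: sigma_algebra_measurable.
  by move=> _ [V [mV _] <-]; exact: (measurable_void_regular MP lambda_gt0).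
apply: (Cov_independent (meas _ _ (loc ru (u, du))) (meas _ _ (loc rv (v, dv)))).
- apply: (independent_regular MP lambda_gt0 (p := u) (a := dist1 u v + (t + t)) _ _ _
    (loc ru (u, du)) (loc rv (v, dv))).
  + move=> x /(boxed_tip (ltW t0)) bx; apply: (@box_sub _ u u (dist1 u v)) bx.
    rewrite /box /= !subrr normr0 ltW// dist1_gt0// => uv.
    by move: tuv; rewrite uv /dist1 !subrr normr0; lra.
  + move=> x /(boxed_tip (ltW t0)) bx; apply: (@box_sub _ u v (dist1 u v)) bx.
    by rewrite /box /dist1 /= !(distrC _ (v.1)) !(distrC _ (v.2)) lerDl lerDr.
  + apply/seteqP; split=> // x [/(dist1_tip (ltW t0)) /= h1 /(dist1_tip (ltW t0)) /=].
    by rewrite dist1C => h2; have := dist1_triangle u x.1 v; lra.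
- exact: A_localized.
- by rewrite /S configC; exact: A_localized.
Qed.

End Covariance.

Theorem theorem2p2 (R : realType) :
  exists c alpha : R, [/\ 0 < c, 0 < alpha &
    forall (lambda : R) (d : measure_display) (Omega : measurableType d)
      (P : probability Omega R)
      (X : nat -> Omega -> R * R) (D : nat -> Omega -> bool),
      0 < lambda -> marked_poisson lambda P X D ->
      forall (u v : R * R) (du dv sigma tau : bool) (t : R),
        u <> v -> 0 < t ->
        let S := config X D (u, du) (v, dv) in
        `| Cov P (A S (Ray (u, du) sigma) t) (A S (Ray (v, dv) tau) t) |
        <= c * expR (- alpha * Num.sqrt lambda * dist1 u v) ].
Proof.
pose p : R := block_prob.
have p0 : 0 < p by rewrite /p /block_prob subr_gt0 ltr_expR; lra.
have p1 : p <= 1.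
  have h : expR (- 35) <= 1 :> R by rewrite expR_le1; lra.
  by have := expR_gt0 (- 36 : R); rewrite /p /block_prob; lra.
(* With [n] the integer part of [y] below, [(1 - p) ^+ n <= expR (- p * n) <= expR (p * (1 - y))];
   the factor [expR p] pays for the rounding. *)
exists (expR p), (p / 160); split; [exact: expR_gt0|by rewrite divr_gt0|].
move=> lambda d Omega P X D l0 MP u v du dv sigma tau t uv t0 /=.
have rho0 := dist1_gt0 uv; set rho := dist1 u v in rho0 *.
have [tr|rt] := lerP t (rho / 16).
  rewrite (Cov_near MP l0); [|by []|by rewrite -/rho; lra].
  by rewrite normr0 mulr_ge0 ?expR_ge0.
have sl0 : 0 < Num.sqrt lambda by rewrite sqrtr_gt0.
pose e := (Num.sqrt lambda)^-1; have e0 : 0 < e by rewrite invr_gt0.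
have le2 : lambda * e ^+ 2 = 1.
  by rewrite /e exprVn sqr_sqrtr ?ltW// divff// gt_eqF.
(* Since [n * (160 * e) <= rho], the stretch [n * (10 * e)] is at most [rho / 16 < t]. The [n] boxes
   reach at most l1 distance [22 * n * e < rho] from [u], so they miss [v]. *)
pose y := Num.sqrt lambda * rho / 160.
have y0 : 0 <= y by rewrite divr_ge0// mulr_ge0// ltW.
pose n := Num.trunc y; have /andP[ny yn] : n%:R <= y < n.+1%:R by exact: truncn_itv.
have nerho : n%:R * (160 * e) <= rho.
  have -> : rho = y * (160 * e) by rewrite /y /e; field; rewrite gt_eqF.
  by rewrite ler_pM2r// mulr_gt0.
have tail : ((P^*)%mu (A (config X D (u, du) (v, dv)) (Ray (u, du) sigma) t)
    <= ((1 - p) ^+ n)%:E)%E.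
  apply: (outer_tail MP l0 (r := Ray (u, du) sigma) e0 le2); first by lra.
  move=> k kn; have k1 : 1 <= k.+1%:R :> R by rewrite ler1n.
  have kn' : k.+1%:R <= n%:R :> R by rewrite ler_nat.
  have zk0 : 0 <= k.+1%:R * (8 * e) by rewrite mulr_ge0// mulr_ge0// ltW.
  have zkn : k.+1%:R * (8 * e) <= n%:R * (8 * e) by rewrite ler_pM2r// mulr_gt0.
  have en : e <= n%:R * e by rewrite -[leLHS]mul1r ler_pM2r// (le_trans k1).
  by move=> /(dist1_tip zk0) /=; rewrite -/rho; lra.
apply: le_trans (Cov_le _ tail) _.
have le1 : 1 - p <= expR (- p) by have := expR_ge1Dx (- p).
apply: le_trans (lerXn2r n _ _ le1) _; rewrite ?nnegrE ?subr_ge0 ?expR_ge0//.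
rewrite -expRM_natl -expRD ler_expR.
have -> : p + - (p / 160) * Num.sqrt lambda * rho = p * (1 - y) by rewrite /y; field.
rewrite mulrN -mulNr mulrC ler_pM2l//.
by move: yn; rewrite -natr1; lra.
Qed.
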